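(* Let $\mathbf c:(0,1)\to(0,1)$ be a function with the finite restricted invertibility property (see context). Let $\mathcal F=\{f_i\}_{i\in I}$ be a Bessel system with Bessel bound $B_{\mathcal F}$ in a Hilbert space $\mathbb H$, with $\|f_i\|\ge u>0$ for all $i\in I$. Let $G$ be a finitely generated Abelian group and assume that either (A) $\mathcal G=\{g_k:k\in G\}$ is a Riesz basis for $\mathbb H$ with Riesz bounds $A_{\mathcal G},B_{\mathcal G}$, or (B) $\mathcal G=\{g_k:k\in G\}$ is a frame for $\mathbb H$ whose dual frame $\widetilde{\mathcal G}=\{\widetilde g_k:k\in G\}$ is $\ell_1$-self-localized. Let $a:I\to G$ be a map with $0<D^-(a;I)\le D^+(a;I)<\infty$. If $(\mathcal F,a,\mathcal G)$ is $\ell_1$-localized, then for every $\epsilon\in(0,1)$ and every $\delta>0$ there is a subset $J=J_{\epsilon\delta}\subseteq I$ of uniform density (with respect to $a$) such that (1) $\displaystyle \frac{D(a;J)}{D^-(a;I)}\ge\frac{(1-\epsilon)u^2}{B_{\mathcal F}}$; (2) for all scalars $\{b_j\}_{j\in J}\in\ell_2(J)$, $$\Big\|\sum_{j\in J}b_jf_j\Big\|^2\ \ge\ \mathbf c(\epsilon)(1-\delta)\,\kappa\,u^2\sum_{j\in J}|b_j|^2,$$ where $\kappa=A_{\mathcal G}/B_{\mathcal G}$ in case (A) and $\kappa=1$ in case (B).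
   Context: Finite restricted invertibility property of $\mathbf c$: $\mathbf c:(0,1)\to(0,1)$ is continuous and monotone, and for every $\epsilon\in(0,1)$, $n\in\mathbb N$, $u>0$, orthonormal basis $\{e_i\}_{i=1}^n$ of $\ell_2^n$ and linear operator $T:\ell_2^n\to\ell_2^n$ with $\|Te_i\|\ge u$ for all $i$, there is $J_\epsilon\subseteq\{1,\dots,n\}$ with $|J_\epsilon|/n\ge(1-\epsilon)u^2/\|T\|^2$ and $\|\sum_{j\in J_\epsilon}b_jTe_j\|^2\ge\mathbf c(\epsilon)u^2\sum_{j\in J_\epsilon}|b_j|^2$ for all scalars $b_j$. (Such a function exists.) $I$ is a countable index set and $G=\mathbb Z^{d_1}\times\mathbb Z_{N_1}\times\cdots\times\mathbb Z_{N_{d_2}}$ with $d_1,d_2\in\mathbb N$, where $\mathbb Z_N=\{0,1,\dots,N-1\}$ is the cyclic group of order $N$. For $k\in G$, $R>0$ put $B_R(k)=\{g\in G:\|g-k\|_\infty=\max_{1\le j\le d_1+d_2}|g(j)-k(j)|\le R\}$. Frames: $\{f_i\}_{i\in I}\subseteq\mathbb H$ is a frame with bounds $0<A\le B<\infty$ if $A\|f\|^2\le\sum_i|\langle f,f_i\rangle|^2\le B\|f\|^2$ for all $f\in\mathbb H$; it is Bessel with Bessel bound $B$ if the right-hand inequality holds. The frame operator is $Sf=\sum_i\langle f,f_i\rangle f_i$, and the dual frame is $\{S^{-1}f_i\}_{i\in I}$. A Riesz sequence with Riesz bounds $0<A\le B<\infty$ is a family with $A\sum|a_i|^2\le\|\sum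 a_if_i\|^2\le B\sum|a_i|^2$ for all square-summable scalars; a Riesz basis is a Riesz sequence with dense linear span. Density: for a map $a:I\to G$ (localization map) and $J\subseteq I$, $$D^-(a;J)=\liminf_{R\to\infty}\inf_{k\in G}\frac{|a^{-1}(B_R(k))\cap J|}{|B_R(0)|},\qquad D^+(a;J)=\limsup_{R\to\infty}\sup_{k\in G}\frac{|a^{-1}(B_R(k))\cap J|}{|B_R(0)|}.$$ If the two agree, $J$ has uniform density, and $D(a;J)$ denotes the common value. Localization: for a frame $\mathcal G=\{g_k\}_{k\in G}$ of $\mathbb H$, $\mathcal F=\{f_i\}_{i\in I}\subseteq\mathbb H$ and $a:I\to G$, $(\mathcal F,a,\mathcal G)$ is $\ell_p$-localized ($p=1,2$) if there is $r\in\ell_p(G)$ with $|\langle f_i,g_{k'}\rangle|\le r(a(i)-k')$ for all $i\in I$, $k'\in G$. A frame $\mathcal G=\{g_k\}_{k\in G}$ is $\ell_p$-self-localized if $(\mathcal G,\mathrm{id},\mathcal G)$ is $\ell_p$-localized. *)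

(* Defs.v *)
From HB Require Import structures.
From mathcomp Require Import all_boot all_order all_algebra finmap.
From mathcomp Require Import complex sesquilinear.
From mathcomp Require Import all_classical all_reals all_analysis.

Set Implicit Arguments.
Unset Strict Implicit.
Unset Printing Implicit Defensive.
Import Order.TTheory GRing.Theory Num.Theory.
Import numFieldNormedType.Exports.
Local Open Scope classical_set_scope.
Local Open Scope ring_scope.

(* Everything below is stated for real and for complex Hilbert spaces at once. *)
Variant scalars := RealScalars | ComplexScalars.

Definition scalar_field (R : realType) (s : scalars) : numFieldType :=
  match s with RealScalars => R | ComplexScalars => R[i] end.

Definition sconj (R : realType) (s : scalars) :
    scalar_field R s -> scalar_field R s :=
  match s return scalar_field R s -> scalar_field R s with
  | RealScalars => id
  | ComplexScalars => fun z : R[i] => z^*%C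
  end.
Arguments sconj {R} s.

Definition rpart (R : realType) (s : scalars) : scalar_field R s -> R :=
  match s return scalar_field R s -> R with
  | RealScalars => id
  | ComplexScalars => fun z : R[i] => complex.Re z
  end.
Arguments rpart {R s}.

(* The norm of a normedModType over K takes its values in K, also for K = R[i];
   [nrm] is the same norm with values in R. It applies to K itself too. *)
Definition nrm (R : realType) (s : scalars)
    (V : normedZmodType (scalar_field R s)) (x : V) : R := rpart `|x|.

(* The group Z^d1 x Z_(N 0 + 1) x ... x Z_(N (d2-1) + 1): the j-th cyclic factor
   is written 'I_(N j).+1, so that every order >= 1 is allowed and none is 0. *)
Section CyclicFactors.
Variables (d2 : nat) (N : 'I_d2 -> nat).

Definition torsion := {dffun forall j : 'I_d2, 'I_(N j).+1}.
HB.instance Definition _ := Finite.on torsion.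

Implicit Types x y z : torsion.
Definition torsion0 : torsion := [ffun j => 0].
Definition torsion_opp x : torsion := [ffun j => - x j].
Definition torsion_add x y : torsion := [ffun j => x j + y j].

Fact torsion_addA : associative torsion_add.
Proof. by move=> x y z; apply/ffunP => j; rewrite !ffunE addrA. Qed.
Fact torsion_addC : commutative torsion_add.
Proof. by move=> x y; apply/ffunP => j; rewrite !ffunE addrC. Qed.
Fact torsion_add0 : left_id torsion0 torsion_add.
Proof. by move=> x; apply/ffunP => j; rewrite !ffunE add0r. Qed.
Fact torsion_addN : left_inverse torsion0 torsion_opp torsion_add.
Proof. by move=> x; apply/ffunP => j; rewrite !ffunE addNr. Qed.

HB.instance Definition _ := GRing.isZmodule.Build torsion
  torsion_addA torsion_addC torsion_add0 torsion_addN.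
End CyclicFactors.

Definition fgroup (d1 d2 : nat) (N : 'I_d2 -> nat) : zmodType :=
  ({ffun 'I_d1 -> int} * torsion N)%type.

(* max_j |g(j) - k(j)|, the coordinates in the cyclic factors being the integer
   representatives 0, ..., N j. *)
Definition gdist (d1 d2 : nat) (N : 'I_d2 -> nat) (g k : fgroup d1 N) : nat :=
  maxn (\max_(j < d1) `|g.1 j - k.1 j|%N)
       (\max_(j < d2) `|(g.2 j : nat)%:Z - (k.2 j : nat)%:Z|%N).

Definition gball (R : realType) (d1 d2 : nat) (N : 'I_d2 -> nat)
    (k : fgroup d1 N) (r : R) : set (fgroup d1 N) :=
  [set g | (gdist g k)%:R <= r].

Section Density.
Variables (R : realType) (d1 d2 : nat) (N : 'I_d2 -> nat).
Variables (I : choiceType) (a : I -> fgroup d1 N).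
Local Open Scope ereal_scope.

Definition ball_ratio (J : set I) (r : R) (k : fgroup d1 N) : \bar R :=
  counting (a @^-1` gball k r `&` J) / counting (gball (0 : fgroup d1 N) r).

Definition lower_density (J : set I) : \bar R :=
  limf_einf (fun r : R => ereal_inf (range (ball_ratio J r))) (pinfty_nbhs R).

Definition upper_density (J : set I) : \bar R :=
  limf_esup (fun r : R => ereal_sup (range (ball_ratio J r))) (pinfty_nbhs R).

Definition uniform_density (J : set I) (D : \bar R) : Prop :=
  lower_density J = D /\ upper_density J = D.
End Density.

Section EuclideanSpace.
Variables (R : realType) (s : scalars) (n : nat).
Local Notation K := (scalar_field R s).

(* The norm that the library puts on matrices is the sup norm, so the norm of
   l_2^n is defined here. *)
Definition l2norm (x : 'rV[K]_n) : R :=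
  Num.sqrt (\sum_i nrm (x 0 i : K) ^+ 2).

Definition l2dot (x y : 'rV[K]_n) : K := \sum_i x 0 i * sconj s (y 0 i).

Definition orthonormal_basis (e : n.-tuple 'rV[K]_n) : Prop :=
  basis_of fullv e /\
  forall i j : 'I_n, l2dot (tnth e i) (tnth e j) = (i == j)%:R.

Definition opnorm (T : 'rV[K]_n -> 'rV[K]_n) : R :=
  sup [set l2norm (T x) | x in [set x | l2norm x <= 1]].
End EuclideanSpace.

Definition finite_restricted_invertibility (R : realType) (s : scalars)
    (c : R -> R) : Prop :=
  [/\ forall eps, 0 < eps < 1 -> 0 < c eps < 1,
      {within `]0, 1[, continuous c},
      {in `]0, 1[ &, {homo c : x y / x <= y}} \/
      {in `]0, 1[ &, {homo c : x y /~ x <= y}} &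
      forall (eps : R) (n : nat) (u : R) (e : n.-tuple 'rV[scalar_field R s]_n)
        (T : {linear 'rV[scalar_field R s]_n -> 'rV[scalar_field R s]_n}),
      0 < eps < 1 -> (0 < n)%N -> 0 < u -> orthonormal_basis e ->
      (forall i, u <= l2norm (T (tnth e i))) ->
      exists J : {set 'I_n},
        #|J|%:R / n%:R >= (1 - eps) * u ^+ 2 / opnorm T ^+ 2 /\
        forall b : 'I_n -> scalar_field R s,
          l2norm (\sum_(j in J) b j *: T (tnth e j)) ^+ 2 >=
          c eps * u ^+ 2 * \sum_(j in J) nrm (b j) ^+ 2].

(* The filter of the finite sets of indices ordered by inclusion, along which
   the unordered sums of vectors are taken. *)
Definition finite_sets (X : choiceType) : set_system {fset X} :=
  filter_from setT (fun A : {fset X} => [set B | fsubset A B]).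

Section Systems.
Variables (R : realType) (s : scalars).
Local Notation K := (scalar_field R s).

Definition sqsum (X : choiceType) (J : set X) (b : X -> K) : \bar R :=
  \esum_(i in J) (nrm (b i) ^+ 2)%:E.

Definition in_lp (p : nat) (X : choiceType) (r : X -> R) : Prop :=
  (\esum_(x in [set: X]) (`|r x| ^+ p)%:E < +oo)%E.

Variables (H : completeNormedModType K) (dot : {dot H for sconj s}).

Definition partial_sum (X : choiceType) (J : set X) (x : X -> H)
    (A : {fset X}) : H := \sum_(i <- A | i \in J) x i.

Definition has_sum (X : choiceType) (J : set X) (x : X -> H) (v : H) : Prop :=
  partial_sum J x @ @finite_sets X --> v.

Section Family.
Variables (X : choiceType) (f : X -> H).

Definition bessel_bound (B : R) : Prop :=
  forall h, (sqsum setT (fun i => dot h (f i)) <= (B * nrm h ^+ 2)%:E)%E.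

Definition frame_bounds (A B : R) : Prop :=
  [/\ 0 < A, A <= B, bessel_bound B &
      forall h, ((A * nrm h ^+ 2)%:E <= sqsum setT (fun i => dot h (f i)))%E].

Definition frame : Prop := exists A B : R, frame_bounds A B.

Definition frame_op (h : H) : H :=
  lim (partial_sum setT (fun i => dot h (f i) *: f i) @ @finite_sets X).

(* S^-1 f_i; the frame operator of a frame is bijective, and then this [pinv_] is
   its two-sided inverse. *)
Definition dual_frame (i : X) : H :=
  'pinv_(fun=> 0) [set: H] frame_op (f i).

Definition riesz_sequence (A B : R) : Prop :=
  [/\ 0 < A, A <= B &
      forall b : X -> K, (sqsum setT b < +oo)%E ->
      exists v, [/\ has_sum setT (fun i => b i *: f i) v,
        (A%:E * sqsum setT b <= (nrm v ^+ 2)%:E)%E &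
        ((nrm v ^+ 2)%:E <= B%:E * sqsum setT b)%E]].

Definition linear_span : set H :=
  [set v | exists (A : {fset X}) (b : X -> K), v = \sum_(i <- A) b i *: f i].

Definition riesz_basis (A B : R) : Prop :=
  riesz_sequence A B /\ dense linear_span.
End Family.

Definition localized (p : nat) (X : choiceType) (G : zmodType)
    (f : X -> H) (a : X -> G) (g : G -> H) : Prop :=
  exists2 r : G -> R, in_lp p r &
    forall i k, nrm (dot (f i) (g k)) <= r (a i - k).

Definition self_localized (p : nat) (G : zmodType) (g : G -> H) : Prop :=
  localized p g id g.
End Systems.

(* Main.v *)
Require Import Defs.
From HB Require Import structures.
From mathcomp Require Import all_boot all_order all_algebra finmap.
From mathcomp Require Import complex sesquilinear.
From mathcomp Require Import all_classical all_reals all_analysis.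
From mathcomp Require Import ring lra zify.

Set Implicit Arguments.
Unset Strict Implicit.
Unset Printing Implicit Defensive.
Import Order.TTheory GRing.Theory Num.Theory.
Import numFieldNormedType.Exports.
Local Open Scope classical_set_scope.
Local Open Scope ring_scope.

(** The index group is tiled by cubes of a large radius [r]. In each tile, finite
    restricted invertibility, applied to the vectors localized in the tile, gives
    a subfamily with lower Riesz bound [c eps' u^2] that contains at least a
    fraction [(1 - eps') u^2 / BF] of them. This is possible in a Hilbert space
    because Gram-Schmidt coordinates turn finitely many vectors into the image of
    the standard basis under a matrix, and the Bessel bound bounds the norm of
    this matrix ([finite_subfamily]).

    To glue the tiles together, only vectors localized in an inner cube of radius
    [r - w] are kept, so that vectors of different tiles are localized at points
    more than [w] apart. In case (B) the Gram matrix of the family is dominated by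
    a summable sequence on the group: it is a product of the localized matrices
    [<f i, g k>], [<S^-1 g k, S^-1 g l>] and [<g l, f j>], and such matrices are
    closed under multiplication by convolution ([ell1_dominated_mul],
    [gram_dominated]). In case (A) the same holds for the matrix [<S f i, f j>],
    where [S] is the frame operator of the Riesz basis ([frame_op_dominated]).
    Since a finite upper density bounds the multiplicity of the localization map
    ([upper_density_fibres]), Schur's test ([schur_test]) shows that the
    interaction between different tiles is at most an arbitrarily small multiple
    of the square sum of the coefficients when [w] is large. Hence the form
    [<v, v>], respectively [<S v, v>], is almost the sum of its values on the
    tiles ([block_form_ge]). In case (A) this form lies between the Riesz bounds
    times the square of the norm, which produces the factor [AG / BG].

    Two losses have to be recovered, the interaction between tiles and the points
    near the walls. By continuity of [c] there is [eps' < eps] with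
    [c eps' > c eps (1 - delta)]; the gain in the constant absorbs the first loss
    and the gain from [1 - eps] to [1 - eps'] the second, because the inner cube
    fills almost the whole tile when [r] is large ([cube_volume_ratio]). Selecting
    the same number of vectors in every tile makes the density of the selected
    set uniform ([tiled_uniform_density]), and the bound for finitely supported
    coefficients extends to square summable ones by taking limits
    ([riesz_subfamily]). *)

(** * Scalars and inner products *)

Section Scalars.
Variables (R : realType) (s : scalars).
Local Notation K := (scalar_field R s).

(** Norms and self inner products lie in the image of the reals, so that all
    estimates can be made in [R], for real and complex scalars at once. *)
Definition emb : R -> K :=
  match s return R -> scalar_field R s with
  | RealScalars => id
  | ComplexScalars => fun x : R => (x%:C)%C
  end.

Lemma embD x y : emb (x + y) = emb x + emb y.
Proof. by rewrite /emb; case: s => //; rewrite rmorphD. Qed.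

Lemma embM x y : emb (x * y) = emb x * emb y.
Proof. by rewrite /emb; case: s => //; rewrite rmorphM. Qed.

Lemma emb0 : emb 0 = 0. Proof. by rewrite /emb; case: s. Qed.

Lemma emb1 : emb 1 = 1. Proof. by rewrite /emb; case: s. Qed.

Lemma embX x n : emb (x ^+ n) = emb x ^+ n.
Proof. by elim: n => [|n ih]; rewrite ?emb1 // !exprS embM ih. Qed.

Lemma ler_emb x y : (emb x <= emb y) = (x <= y).
Proof. by rewrite /emb; case: s => //; rewrite lecR. Qed.

Lemma ltr_emb x y : (emb x < emb y) = (x < y).
Proof. by rewrite /emb; case: s => //; rewrite ltcR. Qed.

Lemma emb_inj : injective emb.
Proof. by rewrite /emb; case: s => // x y /complexI. Qed.

Lemma embK : cancel emb (@rpart R s).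
Proof. by rewrite /emb /rpart; case: s. Qed.

Lemma rpartK_ge0 (x : K) : 0 <= x -> emb (rpart x) = x.
Proof.
rewrite /emb /rpart; move: x; case: s => // x x0.
by apply: RRe_real; rewrite realE x0.
Qed.

Lemma rpartD (x y : K) : rpart (x + y) = rpart x + rpart y.
Proof. by move: x y; rewrite /rpart; case: s => // -[a b] [c d]. Qed.

Lemma rpartN (x : K) : rpart (- x) = - rpart x.
Proof. by move: x; rewrite /rpart; case: s => // -[a b]. Qed.

Lemma rpart0 : rpart (0 : K) = 0. Proof. by rewrite -emb0 embK. Qed.

Lemma rpart_sum (X : Type) (r : seq X) (P : pred X) (F : X -> K) :
  rpart (\sum_(i <- r | P i) F i) = \sum_(i <- r | P i) rpart (F i).
Proof. by apply: (big_morph _ rpartD rpart0). Qed.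

Lemma rpart_embM (x : R) (y : K) : rpart (emb x * y) = x * rpart y.
Proof.
by move: y; rewrite /rpart /emb; case: s => // -[c d] /=; rewrite mul0r subr0.
Qed.

Lemma sconjD (x y : K) : sconj s (x + y) = sconj s x + sconj s y.
Proof. by move: x y; rewrite /sconj; case: s => // x y; rewrite rmorphD. Qed.

Lemma sconjM (x y : K) : sconj s (x * y) = sconj s x * sconj s y.
Proof. by move: x y; rewrite /sconj; case: s => // x y; rewrite rmorphM. Qed.

Lemma sconjK : involutive (sconj s : K -> K).
Proof. by rewrite /sconj; case: s => //; exact: conjcK. Qed.

Lemma sconj_emb x : sconj s (emb x) = emb x.
Proof. by rewrite /sconj /emb; case: s => //=; rewrite oppr0. Qed.

Lemma sconj0 : sconj s (0 : K) = 0. Proof. by rewrite -emb0 sconj_emb. Qed.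

Lemma sconjN (x : K) : sconj s (- x) = - sconj s x.
Proof. by apply/eqP; rewrite -addr_eq0 -sconjD addNr sconj0. Qed.

Lemma sconj_sum (X : Type) (r : seq X) (P : pred X) (F : X -> K) :
  sconj s (\sum_(i <- r | P i) F i) = \sum_(i <- r | P i) sconj s (F i).
Proof. by apply: (big_morph _ sconjD sconj0). Qed.

Lemma rpart_sconj (x : K) : rpart (sconj s x) = rpart x.
Proof. by move: x; rewrite /rpart /sconj; case: s => // -[]. Qed.

Lemma sqr_normK (x : K) : `|x| ^+ 2 = x * sconj s x.
Proof.
move: x; rewrite /sconj; case: s => x; last exact: sqr_normc.
by rewrite real_normK ?num_real.
Qed.

Lemma ler_nrm_rpart (x : K) : `|rpart x| <= nrm x.
Proof.
have ReC (z : R[i]) : `|complex.Re z| <= complex.Re `|z|.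
  by rewrite -lecR RRe_real ?normr_real ?normc_ge_Re.
by move: x; rewrite /nrm /rpart; case: s => // x; exact: ReC.
Qed.

Section Norm.
Variable V : normedZmodType K.
Implicit Types x y : V.

Lemma emb_nrm x : emb (nrm x) = `|x|. Proof. exact: rpartK_ge0. Qed.

Lemma nrm_ge0 x : 0 <= nrm x. Proof. by rewrite -ler_emb emb_nrm emb0. Qed.

Lemma nrm0 : nrm (0 : V) = 0. Proof. by rewrite /nrm normr0 rpart0. Qed.

Lemma nrm0_eq0 x : nrm x = 0 -> x = 0.
Proof. by move=> x0; apply/eqP; rewrite -normr_eq0 -emb_nrm x0 emb0. Qed.

Lemma nrmN x : nrm (- x) = nrm x. Proof. by rewrite /nrm normrN. Qed.

Lemma nrmB x y : nrm (x - y) = nrm (y - x).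
Proof. by rewrite -nrmN opprB. Qed.

Lemma ler_nrmD x y : nrm (x + y) <= nrm x + nrm y.
Proof. by rewrite -ler_emb embD !emb_nrm ler_normD. Qed.

Lemma ler_nrm_sum (X : Type) (r : seq X) (P : pred X) (F : X -> V) :
  nrm (\sum_(i <- r | P i) F i) <= \sum_(i <- r | P i) nrm (F i).
Proof.
elim/big_rec2: _ => [|i x y _ h]; first by rewrite nrm0.
by apply: le_trans (ler_nrmD _ _) _; rewrite lerD2l.
Qed.

End Norm.

Lemma nrmM (x y : K) : nrm (x * y) = nrm x * nrm y.
Proof. by apply: emb_inj; rewrite embM !emb_nrm normrM. Qed.

Lemma nrm_emb (x : R) : nrm (emb x) = `|x|.
Proof.
apply: emb_inj; rewrite emb_nrm; case: (leP 0 x) => x0.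
  by rewrite !ger0_norm // -emb0 ler_emb.
have x0' : emb x <= 0 by rewrite -emb0 ler_emb ltW.
rewrite (ler0_norm x0') (ltr0_norm x0).
by apply/eqP; rewrite eq_sym -subr_eq0 opprK -embD addrC subrr emb0.
Qed.

Lemma nrmZ (V : normedModType K) (k : K) (x : V) :
  nrm (k *: x) = nrm k * nrm x.
Proof. by apply: emb_inj; rewrite embM !emb_nrm normrZ. Qed.

Lemma mul_sconj (x : K) : x * sconj s x = emb (nrm x ^+ 2).
Proof. by rewrite embX emb_nrm sqr_normK. Qed.

Lemma nrm_sconj (x : K) : nrm (sconj s x) = nrm x.
Proof.
apply/eqP; rewrite -(@eqrXn2 _ 2) ?nrm_ge0 //; apply/eqP/emb_inj.
by rewrite -!mul_sconj sconjK mulrC.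
Qed.

End Scalars.
Arguments emb {R} s.

Section DotProduct.
Variables (R : realType) (s : scalars).
Local Notation K := (scalar_field R s).
Variables (H : completeNormedModType K) (dot : {dot H for sconj s}).
Hypothesis hdot : forall h : H, dot h h = `|h| ^+ 2.
Implicit Types x y z : H.

Lemma dotBl z : {morph dot^~ z : x y / x - y}.
Proof. by move=> x y; rewrite linearBl. Qed.
Lemma dotBr z : {morph dot z : x y / x - y}.
Proof. by move=> x y; rewrite linearBr. Qed.
Lemma dot0l z : dot 0 z = 0. Proof. by rewrite linear0l. Qed.
Lemma dot0r z : dot z 0 = 0. Proof. by rewrite linear0r. Qed.
Lemma dotDl z : {morph dot^~ z : x y / x + y}.
Proof. by move=> x y; rewrite linearDl. Qed.
Lemma dotDr z : {morph dot z : x y / x + y}.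
Proof. by move=> x y; rewrite linearDr. Qed.
Lemma dotZl z (k : K) x : dot (k *: x) z = k * dot x z.
Proof. by rewrite linearZl_LR. Qed.
Lemma dotZr z (k : K) x : dot z (k *: x) = sconj s k * dot z x.
Proof. by rewrite linearZr_LR. Qed.
Lemma dotC x y : dot x y = sconj s (dot y x).
Proof. by rewrite (@hermitian_subproof _ _ _ _ dot) expr0 mul1r. Qed.

Lemma dot_suml z (X : Type) (r : seq X) (P : pred X) (F : X -> H) :
  dot (\sum_(i <- r | P i) F i) z = \sum_(i <- r | P i) dot (F i) z.
Proof. exact: (big_morph (dot^~ z) (dotDl z) (dot0l z)). Qed.

Lemma dot_sumr z (X : Type) (r : seq X) (P : pred X) (F : X -> H) :
  dot z (\sum_(i <- r | P i) F i) = \sum_(i <- r | P i) dot z (F i).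
Proof. exact: (big_morph (dot z) (dotDr z) (dot0r z)). Qed.

Lemma nrm_dotC x y : nrm (dot x y) = nrm (dot y x).
Proof. by rewrite dotC nrm_sconj. Qed.

Lemma dot_emb x : dot x x = emb s (nrm x ^+ 2).
Proof. by rewrite hdot embX emb_nrm. Qed.

Lemma nrm_sqrE x : nrm x ^+ 2 = rpart (dot x x).
Proof. by rewrite dot_emb embK. Qed.

Lemma nrm_dot_diag x : nrm (dot x x) = nrm x ^+ 2.
Proof. by rewrite dot_emb nrm_emb ger0_norm // exprn_ge0 // nrm_ge0. Qed.

Lemma nrm_sqrB x y :
  nrm (x - y) ^+ 2 = nrm x ^+ 2 - 2 * rpart (dot x y) + nrm y ^+ 2.
Proof.
rewrite !nrm_sqrE dotBl !dotBr !(rpartD, rpartN) [dot y x]dotC rpart_sconj.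
by ring.
Qed.

Lemma cauchy_schwarz x y : nrm (dot x y) <= nrm x * nrm y.
Proof.
have [->|y0] := eqVneq y 0; first by rewrite dot0r !nrm0 mulr0.
have ny0 : 0 < nrm y.
  by rewrite lt_def nrm_ge0 andbT; apply: contra_neq y0 => /nrm0_eq0.
have := sqr_ge0 (nrm (emb s (nrm y ^+ 2) *: x - dot x y *: y)).
rewrite nrm_sqrB !nrmZ nrm_emb dotZl dotZr [_ * dot x y]mulrC mul_sconj -embM embK.
rewrite ger0_norm ?sqr_ge0 // => h.
suff : nrm (dot x y) ^+ 2 <= (nrm x * nrm y) ^+ 2.
  by rewrite ler_pXn2r // nnegrE ?mulr_ge0 ?nrm_ge0.
rewrite -(ler_pM2l (_ : 0 < nrm y ^+ 2)) ?exprn_gt0 //.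
move: h; set N := nrm y; set M := nrm x; set D := nrm (dot x y) => h.
rewrite -subr_ge0; apply: le_trans h _; rewrite le_eqVlt; apply/orP; left.
by apply/eqP; ring.
Qed.

End DotProduct.

(** * Unordered sums and Bessel families *)

Lemma big_fsetU_disjoint (T : Type) (idx : T) (op : Monoid.com_law idx)
    (X : choiceType) (A B : {fset X}) (F : X -> T) : [disjoint A & B]%fset ->
  \big[op/idx]_(i <- (A `|` B)%fset) F i =
  op (\big[op/idx]_(i <- A) F i) (\big[op/idx]_(i <- B) F i).
Proof.
move=> /fdisjointP dAB; rewrite (big_fsetID _ (mem A)) /=.
congr (op _ _); apply: eq_fbigl => i; rewrite !inE /=.
  by case: (i \in A); rewrite ?andbF.
by case: (boolP (i \in A)) => [/dAB/negbTE->|]; rewrite ?andbT.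
Qed.

Section FiniteSums.
Variables (R : realType) (X : choiceType).
Local Open Scope ereal_scope.

Lemma esum_fset_le (J : set X) (t : X -> \bar R) (A : {fset X}) :
  (forall i, 0 <= t i) -> (forall i, i \in A -> J i) ->
  \sum_(i <- A) t i <= \esum_(i in J) t i.
Proof.
move=> t0 AJ; apply: esum_ge; exists [set` A].
  by split; [exact: finite_fset|move=> i /AJ].
by rewrite fsbig_finite //= set_fsetK.
Qed.

Lemma esum_le_fset (J : set X) (t : X -> \bar R) x :
  (forall A : {fset X}, (forall i, i \in A -> J i) -> \sum_(i <- A) t i <= x) ->
  \esum_(i in J) t i <= x.
Proof.
move=> h; apply: ge_ereal_sup => _ [A [finA AJ] <-].
rewrite fsbig_finite //; apply: h => i.
by rewrite in_fset_set // inE => /AJ.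
Qed.

Lemma esum_tail (J : set X) (t : X -> \bar R) (e : R) :
  (forall i, 0 <= t i) -> \esum_(i in J) t i < +oo -> (0 < e)%R ->
  exists2 A : {fset X}, (forall i, i \in A -> J i) &
    forall B : {fset X}, (forall i, i \in B -> J i) -> [disjoint A & B]%fset ->
      \sum_(i <- B) t i <= e%:E.
Proof.
move=> t0 tfin e0; have : \esum_(i in J) t i - e%:E < \esum_(i in J) t i.
  by rewrite lteBlDr // lteDl ?lte_fin // ge0_fin_numE // esum_ge0.
move=> /ereal_sup_gt[_ [A [finA AJ] <-]]; rewrite fsbig_finite // => hA.
exists (fset_set A) => [i|B BJ dAB]; first by rewrite in_fset_set // inE => /AJ.
move: hA; rewrite lteBlDr // => hA.
have h : \sum_(i <- fset_set A) t i + \sum_(i <- B) t i <= \esum_(i in J) t i.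
  rewrite -big_fsetU_disjoint //=; apply: esum_fset_le => // i.
  by rewrite inE => /orP[|/BJ//]; rewrite in_fset_set // inE => /AJ.
have fA : \sum_(i <- fset_set A) t i \is a fin_num.
  rewrite ge0_fin_numE ?sume_ge0 //; apply: le_lt_trans tfin.
  by apply: le_trans h; rewrite leeDl // sume_ge0.
by move: (le_trans h (ltW hA)); rewrite leeD2lE.
Qed.

End FiniteSums.

Global Instance finite_sets_proper (X : choiceType) :
  ProperFilter (@finite_sets X).
Proof.
apply: filter_from_proper; last by move=> A _; exists A; exact: fsubset_refl.
apply: filter_from_filter; first by exists fset0.
move=> A B _ _; exists (A `|` B)%fset => // C /= /fsubUsetP[AC BC].
by split.
Qed.

Section UnorderedSums.
Variables (R : realType) (s : scalars).
Local Notation K := (scalar_field R s).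
Variables (H : completeNormedModType K) (dot : {dot H for sconj s}).
Hypothesis hdot : forall h : H, dot h h = `|h| ^+ 2.
Variable X : choiceType.
Implicit Types (J : set X) (x : X -> H) (v : H) (A B : {fset X}).

Lemma finite_setsE (P : set {fset X}) :
  finite_sets P <-> exists A, forall B, (A `<=` B)%fset -> P B.
Proof.
by split=> [[A _ h]|[A h]]; exists A.
Qed.

Lemma has_sumP J x v : has_sum J x v <->
  forall e : R, 0 < e -> exists A, forall B, (A `<=` B)%fset ->
    nrm (v - partial_sum J x B) < e.
Proof.
split=> [/cvgrPdist_lt h e e0|h].
  have /h/finite_setsE[A hA] : 0 < emb s e by rewrite -(emb0 R s) ltr_emb.
  by exists A => B /hA; rewrite -emb_nrm ltr_emb.
apply/cvgrPdist_lt => e e0; have eE := rpartK_ge0 (ltW e0).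
have : 0 < rpart e by rewrite -(ltr_emb s) eE emb0.
move=> /h[A hA]; apply/finite_setsE; exists A => B /hA.
by rewrite -(ltr_emb s) emb_nrm eE.
Qed.

Lemma has_sum_unique J x v w : has_sum J x v -> has_sum J x w -> v = w.
Proof. by move=> hv hw; apply: (cvg_unique _ hv hw); exact: norm_hausdorff. Qed.

Lemma has_sum_nrm_le J x v (C : R) : has_sum J x v ->
  (forall A, nrm (partial_sum J x A) <= C) -> nrm v <= C.
Proof.
move=> /has_sumP hv hC; apply/ler_addgt0Pr => e e0.
have [A /(_ A (fsubset_refl _)) hA] := hv _ e0.
rewrite -[v](subrK (partial_sum J x A)) addrC.
by apply: le_trans (ler_nrmD _ _) _; rewrite lerD // ltW.
Qed.

Lemma has_sum_nrm_ge J x v (C : R) A0 : has_sum J x v ->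
  (forall A, (A0 `<=` A)%fset -> C <= nrm (partial_sum J x A)) -> C <= nrm v.
Proof.
move=> /has_sumP hv hC; apply/ler_addgt0Pr => e e0.
have [A /(_ (A `|` A0)%fset (fsubsetUl _ _)) hA] := hv _ e0.
apply: le_trans (hC (A `|` A0)%fset (fsubsetUr _ _)) _.
set p := partial_sum _ _ _ in hA *.
rewrite -[p](subKr v) -[v - (v - p)]/(v + - (v - p)).
by apply: le_trans (ler_nrmD _ _) _; rewrite lerD2l nrmN ltW.
Qed.

Lemma partial_sum_dot J x A z :
  dot (partial_sum J x A) z = \sum_(i <- A | i \in J) dot (x i) z.
Proof. exact: dot_suml. Qed.

Lemma has_sum_dot J x v z : has_sum J x v ->
  forall e : R, 0 < e -> exists A, forall B, (A `<=` B)%fset ->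
    nrm (dot v z - \sum_(i <- B | i \in J) dot (x i) z) < e.
Proof.
move=> /has_sumP hv e e0.
have z1 : 0 < nrm z + 1 by rewrite ltr_wpDl ?nrm_ge0.
have [A hA] := hv _ (divr_gt0 e0 z1).
exists A => B /hA hB; rewrite -partial_sum_dot -dotBl.
apply: le_lt_trans (cauchy_schwarz hdot _ _) _.
move: hB; rewrite ltr_pdivlMr // => hB; apply: le_lt_trans _ hB.
by rewrite ler_wpM2l ?nrm_ge0 // lerDl.
Qed.

Lemma has_sum_dot_esum J x v z : has_sum J x v ->
  ((nrm (dot v z))%:E <= \esum_(i in J) (nrm (dot (x i) z))%:E)%E.
Proof.
move=> hv; apply/lee_addgt0Pr => e e0.
have [A /(_ A (fsubset_refl _)) hA] := has_sum_dot z hv e0.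
apply: (@le_trans _ _ ((nrm (\sum_(i <- A | i \in J) dot (x i) z))%:E + e%:E)%E).
  rewrite -EFinD lee_fin -lerBlDl; apply: le_trans (ltW hA).
  by rewrite lerBlDr; apply: le_trans (ler_nrmD _ _); rewrite subrK.
rewrite leeD2r // big_fset_condE /=.
apply: (@le_trans _ _
    (\sum_(i <- [fset i in A | i \in J]%fset) nrm (dot (x i) z))%:E).
  by rewrite lee_fin ler_nrm_sum.
rewrite -sumEFin; apply: esum_fset_le => i; rewrite ?lee_fin ?nrm_ge0 //.
by rewrite !inE => /andP[_ /set_mem].
Qed.

End UnorderedSums.

Lemma nrm_sqrD_le (R : realType) (s : scalars)
    (V : normedZmodType (scalar_field R s)) (t : R) (t0 : 0 < t) (x y : V) :
  nrm (x + y) ^+ 2 <= (1 + t) * nrm x ^+ 2 + (1 + t^-1) * nrm y ^+ 2.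
Proof.
apply: (@le_trans _ _ ((nrm x + nrm y) ^+ 2)).
  by rewrite ler_pXn2r ?nnegrE ?addr_ge0 ?nrm_ge0 // ler_nrmD.
rewrite -subr_ge0 (_ : _ - _ = t^-1 * (t * nrm x - nrm y) ^+ 2).
  by rewrite mulr_ge0 ?sqr_ge0 // invr_ge0 ltW.
by field; rewrite gt_eqF.
Qed.

Section Bessel.
Variables (R : realType) (s : scalars).
Local Notation K := (scalar_field R s).
Variables (H : completeNormedModType K) (dot : {dot H for sconj s}).
Hypothesis hdot : forall h : H, dot h h = `|h| ^+ 2.
Variables (X : choiceType) (f : X -> H).
Implicit Types (J : set X) (b : X -> K) (v h : H) (A B : {fset X}).

Lemma sqsum_fset_le J b A : (forall i, i \in A -> J i) ->
  ((\sum_(i <- A) nrm (b i) ^+ 2)%:E <= sqsum J b)%E.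
Proof.
move=> AJ; rewrite -sumEFin; apply: esum_fset_le => // i.
by rewrite lee_fin sqr_ge0.
Qed.

Lemma bessel_fset (BF : R) h A : bessel_bound dot f BF ->
  \sum_(i <- A) nrm (dot h (f i)) ^+ 2 <= BF * nrm h ^+ 2.
Proof.
move=> hf; rewrite -lee_fin; apply: le_trans (hf h).
exact: sqsum_fset_le.
Qed.

(** With the weight [t] equal to the frame or Riesz bound at hand, this yields
    the duality between analysis and synthesis with the sharp constant, just as
    the Cauchy-Schwarz inequality would. *)
Lemma sum_mul_amgm (t : R) (I : Type) (r : seq I) (p q : I -> R) : 0 < t ->
  \sum_(i <- r) p i * q i <=
  (t * \sum_(i <- r) p i ^+ 2 + t^-1 * \sum_(i <- r) q i ^+ 2) / 2.
Proof.
move=> t0; rewrite !mulr_sumr -big_split mulr_suml; apply: ler_sum => i _.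
rewrite /= ler_pdivlMr // -subr_ge0.
rewrite (_ : _ - _ = t^-1 * (t * p i - q i) ^+ 2).
  by rewrite mulr_ge0 ?sqr_ge0 // invr_ge0 ltW.
by field; rewrite gt_eqF.
Qed.

Lemma nrm_sqr_synthesis b A v : v = \sum_(i <- A) b i *: f i ->
  nrm v ^+ 2 <= \sum_(i <- A) nrm (b i) * nrm (dot v (f i)).
Proof.
move=> vE; rewrite -(nrm_dot_diag hdot) [in X in dot X _]vE dot_suml.
apply: le_trans (ler_nrm_sum _ _ _) _; apply: ler_sum => i _.
by rewrite dotZl nrmM [nrm (dot v _)]nrm_dotC.
Qed.

Lemma bessel_synthesis (BF : R) b A : 0 < BF -> bessel_bound dot f BF ->
  nrm (\sum_(i <- A) b i *: f i) ^+ 2 <= BF * \sum_(i <- A) nrm (b i) ^+ 2.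
Proof.
move=> BF0 hf; set v := \sum_(i <- A) _.
have h1 := nrm_sqr_synthesis (erefl v).
have h2 := sum_mul_amgm A (fun i => nrm (b i)) (fun i => nrm (dot v (f i))) BF0.
have h3 : BF^-1 * \sum_(i <- A) nrm (dot v (f i)) ^+ 2 <= nrm v ^+ 2.
  by rewrite ler_pdivrMl // bessel_fset.
move: h1 h2 h3 => /=; set p := nrm v ^+ 2; set q := \sum_(i <- A) nrm _ ^+ 2.
by lra.
Qed.

(** By the synthesis bound, the tails of the square sum of the coefficients
    control the Cauchy differences of the partial sums. *)
Lemma bessel_has_sum (BF : R) J b : 0 < BF -> bessel_bound dot f BF ->
  (sqsum J b < +oo)%E -> exists v, has_sum J (fun i => b i *: f i) v.
Proof.
move=> BF0 hf hb; apply/cvg_ex/cauchy_cvgP/cauchy_exP => e e0.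
have eE := rpartK_ge0 (ltW e0).
have re0 : 0 < rpart e by rewrite -(ltr_emb s) eE emb0.
have d0 : 0 < (rpart e / 2) ^+ 2 / BF by rewrite divr_gt0 // exprn_gt0 // divr_gt0.
have [|A AJ hA] := @esum_tail R X J (fun i => (nrm (b i) ^+ 2)%:E) _ _ hb d0.
  by move=> i; rewrite lee_fin sqr_ge0.
exists (partial_sum J (fun i => b i *: f i) A).
apply/finite_setsE; exists A => B AB; rewrite -ball_normE /ball_ /= -emb_nrm -eE ltr_emb.
have -> : partial_sum J (fun i => b i *: f i) A - partial_sum J (fun i => b i *: f i) B
   = - \sum_(i <- [fset i in B | (i \in J) && (i \notin A)]%fset) b i *: f i.
  rewrite /partial_sum [in X in _ - X](big_fsetIDcond _ (mem A) B) /= opprD addrA.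
  have -> : [fset i in B | i \in A]%fset = A.
    by apply/fsetP => i; rewrite !inE andbC; case: (boolP (i \in A)) => //= /(fsubsetP AB).
  rewrite subrr sub0r; congr (- _); rewrite big_fset_condE /=; apply: eq_fbigl => i.
  by rewrite !inE -andbA [(i \notin A) && _]andbC.
rewrite nrmN; apply: (@le_lt_trans _ _ (rpart e / 2)); last first.
  by rewrite ltr_pdivrMr // ltr_pMr // ltr1n.
rewrite -(@ler_pXn2r _ 2) ?nnegrE ?nrm_ge0 ?divr_ge0 ?(ltW re0) //.
apply: le_trans (bessel_synthesis _ _ BF0 hf) _.
rewrite -ler_pdivlMl // mulrC -lee_fin -sumEFin; apply: hA => [i|].
  by rewrite !inE => /andP[_ /andP[/set_mem]].
by apply/fdisjointP => i iA; rewrite !inE iA /= !andbF.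
Qed.

End Bessel.

(** * The frame operator, dual frames and Riesz bases *)

Section FrameOperator.
Variables (R : realType) (s : scalars).
Local Notation K := (scalar_field R s).
Variables (H : completeNormedModType K) (dot : {dot H for sconj s}).
Hypothesis hdot : forall h : H, dot h h = `|h| ^+ 2.
Variables (X : choiceType) (g : X -> H) (A B : R).
Hypothesis hg : frame_bounds dot g A B.
Local Notation S := (frame_op dot g).
Implicit Types (h x y z : H) (F : {fset X}).

Let A0 : 0 < A. Proof. by case: hg. Qed.
Let B0 : 0 < B. Proof. by case: hg => ? /(lt_le_trans A0). Qed.
Let gB : bessel_bound dot g B. Proof. by case: hg. Qed.

Lemma frame_op_has_sum h : has_sum setT (fun i => dot h (g i) *: g i) (S h).
Proof.
have [|v hv] := bessel_has_sum hdot B0 gB (J := setT) (b := fun i => dot h (g i)).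
  by apply: le_lt_trans (gB h) _; rewrite ltry.
rewrite /frame_op (_ : lim _ = v) //.
by apply: cvg_lim hv; exact: norm_hausdorff.
Qed.

Lemma frame_op_dot_le h z :
  ((nrm (dot (S h) z))%:E <=
   \esum_(i in [set: X]) (nrm (dot h (g i)) * nrm (dot (g i) z))%:E)%E.
Proof.
have h1 := has_sum_dot_esum hdot z (@frame_op_has_sum h); apply: le_trans h1 _.
by apply: le_esum => i _; rewrite dotZl nrmM.
Qed.

Lemma frame_op_dot h z : forall e : R, 0 < e -> exists F, forall F',
  (F `<=` F')%fset ->
  nrm (dot (S h) z - \sum_(i <- F') dot h (g i) * dot (g i) z) < e.
Proof.
move=> e e0; have [F hF] := has_sum_dot hdot z (@frame_op_has_sum h) e0.
exists F => F' /hF; under eq_bigr do rewrite dotZl.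
by rewrite (eq_bigl xpredT) // => i; rewrite in_setT.
Qed.

Lemma frame_opP k x y : S (k *: x + y) = k *: S x + S y.
Proof.
apply: has_sum_unique (@frame_op_has_sum _) _.
rewrite /has_sum (_ : partial_sum _ _ = (fun F =>
    k *: partial_sum setT (fun i => dot x (g i) *: g i) F
    + partial_sum setT (fun i => dot y (g i) *: g i) F)).
  by apply: cvgD; [apply: cvgZr|]; exact: frame_op_has_sum.
apply/funext => F; rewrite /partial_sum scaler_sumr -big_split.
by apply: eq_bigr => i _; rewrite dotDl dotZl scalerDl scalerA.
Qed.

Lemma frame_op0 : S 0 = 0.
Proof. by have := frame_opP (-1) 0 0; rewrite scaler0 addr0 scaleN1r addNr. Qed.

Lemma frame_opD : {morph S : x y / x + y}.
Proof. by move=> x y; have := frame_opP 1 x y; rewrite !scale1r. Qed.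

Lemma frame_opZ k x : S (k *: x) = k *: S x.
Proof. by have := frame_opP k x 0; rewrite frame_op0 !addr0. Qed.

(** The partial sums of both sides are equal over every finite index set. *)
Lemma frame_op_selfadjoint x y : dot (S x) y = dot x (S y).
Proof.
apply/eqP; rewrite -subr_eq0; apply/eqP/nrm0_eq0/eqP.
rewrite eq_le nrm_ge0 andbT; apply/ler_addgt0Pr => e e0; rewrite add0r.
have e2 : 0 < e / 2 by rewrite divr_gt0.
have [F hF] := frame_op_dot x y e2; have [F' hF'] := frame_op_dot y x e2.
have {hF}h1 := hF _ (fsubsetUl F F'); have {hF'}h2 := hF' _ (fsubsetUr F F').
set p := \sum_(i <- _) _ in h1; set q := \sum_(i <- _) _ in h2.
have qE : sconj s q = p.
  rewrite sconj_sum; apply: eq_bigr => i _.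
  by rewrite sconjM -!dotC mulrC.
have {}h2 : nrm (p - dot x (S y)) < e / 2.
  by rewrite -qE [dot x _]dotC -sconjN -sconjD nrm_sconj nrmB.
rewrite -[_ - _](subrKA p); apply: le_trans (ler_nrmD _ _) _.
by rewrite [e]splitr lerD // ltW.
Qed.

Lemma frame_op_lower h : A * nrm h ^+ 2 <= rpart (dot (S h) h).
Proof.
case: hg => _ _ _ /(_ h) hA; rewrite -lee_fin; apply: le_trans hA _.
apply: esum_le_fset => F _; rewrite sumEFin lee_fin.
apply/ler_addgt0Pr => e e0; have [F' hF'] := frame_op_dot h h e0.
have {hF'}h1 := hF' _ (fsubsetUr F F'); rewrite -lerBlDl.
have [rest rest0 restE] : exists2 rest : R, 0 <= rest &
    \sum_(i <- (F `|` F')%fset) dot h (g i) * dot (g i) h =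
    emb s (\sum_(i <- F) nrm (dot h (g i)) ^+ 2 + rest).
  exists (\sum_(i <- ((F `|` F') `\` F)%fset) nrm (dot h (g i)) ^+ 2).
    by apply: sumr_ge0 => i _; exact: sqr_ge0.
  have -> : (F `|` F' = F `|` ((F `|` F') `\` F))%fset.
    by apply/fsetP => i; rewrite !inE; case: (i \in F).
  rewrite -big_fsetU_disjoint; last by apply/fdisjointP => i iF; rewrite !inE iF.
  have -> : (F `|` ((F `|` (F `|` F') `\` F) `\` F) = F `|` ((F `|` F') `\` F))%fset.
    by apply/fsetP => i; rewrite !inE; case: (i \in F).
  rewrite (big_morph _ (@embD R s) (emb0 R s)); apply: eq_bigr => i _.
  by rewrite [dot (g i) h]dotC mul_sconj.
rewrite restE in h1; have := le_lt_trans (ler_nrm_rpart _) h1.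
rewrite rpartD rpartN embK ltr_norml => /andP[]; move: rest0.
by move: (rpart _) (\sum_(i <- F) _) => p q; lra.
Qed.

Lemma frame_op_upper h : rpart (dot (S h) h) <= B * nrm h ^+ 2.
Proof.
apply: le_trans (ler_norm _) _; apply: le_trans (ler_nrm_rpart _) _.
rewrite -lee_fin; apply: le_trans (frame_op_dot_le _ _) _.
apply: le_trans (gB h); apply: le_esum => i _.
by rewrite lee_fin [nrm (dot (g i) _)]nrm_dotC.
Qed.

Lemma frame_op_bounded h : nrm (S h) <= B * nrm h.
Proof.
apply: has_sum_nrm_le (@frame_op_has_sum h) _ => F.
rewrite -(@ler_pXn2r _ 2) ?nnegrE ?nrm_ge0 ?mulr_ge0 ?nrm_ge0 ?(ltW B0) //.
rewrite /partial_sum (eq_bigl xpredT); last by move=> i; rewrite in_setT.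
apply: le_trans (bessel_synthesis hdot _ _ B0 gB) _.
by rewrite exprMn expr2 -mulrA ler_wpM2l ?(ltW B0) // bessel_fset.
Qed.

(** With step [t = A / B^2] the map [x - t S x] is a strict contraction, so the
    Neumann iteration for [S v = y] converges. *)
Lemma frame_op_contraction h :
  nrm (h - emb s (A / B ^+ 2) *: S h) ^+ 2 <= (1 - (A / B) ^+ 2) * nrm h ^+ 2.
Proof.
set t := A / B ^+ 2; have t0 : 0 < t by rewrite divr_gt0 // exprn_gt0.
rewrite (nrm_sqrB hdot) dotZr sconj_emb rpart_embM nrmZ nrm_emb (gtr0_norm t0).
rewrite [dot h _]dotC rpart_sconj exprMn.
have h1 : t * (A * nrm h ^+ 2) <= t * rpart (dot (S h) h).
  by rewrite ler_wpM2l ?(ltW t0) // frame_op_lower.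
have h2 : t ^+ 2 * nrm (S h) ^+ 2 <= t ^+ 2 * (B ^+ 2 * nrm h ^+ 2).
  rewrite ler_wpM2l ?sqr_ge0 // -exprMn ler_pXn2r ?nnegrE ?nrm_ge0 //.
    exact: frame_op_bounded.
  by rewrite mulr_ge0 ?nrm_ge0 ?(ltW B0).
have tA : t * A = (A / B) ^+ 2.
  by rewrite /t; field; rewrite gt_eqF.
have tB : t ^+ 2 * B ^+ 2 = (A / B) ^+ 2.
  by rewrite /t; field; rewrite gt_eqF.
rewrite mulrA tA in h1; rewrite mulrA tB in h2; move: h1 h2.
by rewrite mulrBl mul1r; move: (rpart _) (_ * nrm (S h) ^+ 2) => p q; lra.
Qed.

Lemma frame_op_surjective y : exists x, S x = y.
Proof.
set t := A / B ^+ 2; have t0 : 0 < t by rewrite divr_gt0 // exprn_gt0.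
pose res := fix res n := if n is n'.+1 then res n' - emb s t *: S (res n') else y.
pose sol n := \sum_(i < n) emb s t *: res i.
have solE n : y - S (sol n) = res n.
  elim: n => [|n ih]; first by rewrite /sol big_ord0 frame_op0 subr0.
  by rewrite /sol big_ord_recr /= -/(sol n) frame_opD frame_opZ opprD addrA ih.
pose q := Num.sqrt (1 - (A / B) ^+ 2).
have AB : 0 < (A / B) ^+ 2 <= 1.
  rewrite exprn_gt0 ?divr_gt0 //= expr_le1 ?divr_ge0 ?(ltW A0) ?(ltW B0) //.
  by rewrite ler_pdivrMr // mul1r; case: hg.
have q0 : 0 <= q by exact: sqrtr_ge0.
have q1 : q < 1.
  rewrite -(@ltr_pXn2r _ 2) ?nnegrE // sqr_sqrtr; last by lra.
  by rewrite expr1n; lra.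
have resE n : nrm (res n) <= q ^+ n * nrm y.
  elim: n => [|n ih]; first by rewrite expr0 mul1r.
  have h1 : nrm (res n.+1) <= q * nrm (res n).
    rewrite -(@ler_pXn2r _ 2) ?nnegrE ?nrm_ge0 ?mulr_ge0 ?nrm_ge0 //.
    rewrite exprMn sqr_sqrtr; first exact: frame_op_contraction.
    by lra.
  by apply: le_trans h1 _; rewrite exprS -mulrA ler_wpM2l.
(* The increments of [sol] are dominated by a geometric series with sum [C]. *)
pose C := t * nrm y / (1 - q).
have q1' : 0 < 1 - q by lra.
have C0 : 0 <= C by exact: divr_ge0 (mulr_ge0 (ltW t0) (nrm_ge0 y)) (ltW q1').
have solD n k : nrm (sol (n + k)%N - sol n) <= C * (q ^+ n - q ^+ (n + k)).
  elim: k => [|k ih]; first by rewrite addn0 !subrr nrm0 mulr0.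
  rewrite addnS /sol big_ord_recr /= -/(sol n) -/(sol (n + k)%N) addrAC.
  apply: le_trans (ler_nrmD _ _) _.
  have h1 : nrm (emb s t *: res (n + k)%N) <= C * (q ^+ (n + k) - q ^+ (n + k).+1).
    rewrite nrmZ nrm_emb gtr0_norm // exprS.
    apply: (@le_trans _ _ (t * (q ^+ (n + k) * nrm y))).
      by rewrite ler_wpM2l ?(ltW t0).
    rewrite le_eqVlt; apply/orP; left; apply/eqP; rewrite /C; field.
    by rewrite gt_eqF.
  by move: ih h1; rewrite !mulrBr; lra.
have small e : 0 < e -> exists n, forall m, (n <= m)%N -> C * q ^+ m < e /\ q ^+ m * nrm y < e.
  move=> e0; have M0 : 0 < C + nrm y + 1 by rewrite ltr_wpDl ?addr_ge0 ?nrm_ge0.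
  have hq : (fun n => q ^+ n) @ \oo --> (0 : R) by apply: cvg_expr; rewrite ger0_norm.
  move/cvgrPdist_lt : hq => /(_ _ (divr_gt0 e0 M0))[n _ hn].
  exists n => m /hn; rewrite sub0r normrN ger0_norm ?exprn_ge0 // ltr_pdivlMr // => h.
  have qm0 := exprn_ge0 m q0.
  have hC := mulr_ge0 qm0 C0; have hy := mulr_ge0 qm0 (nrm_ge0 y).
  by move: h hC hy; rewrite [C * _]mulrC !mulrDr mulr1; lra.
have : cvg (sol @ \oo).
  apply/cauchy_cvgP/cauchy_exP => e e0.
  have re0 : 0 < rpart e by rewrite -(ltr_emb s) rpartK_ge0 ?ltW // emb0.
  have [n hn] := small _ re0; exists (sol n); exists n => // m /= nm.
  rewrite -ball_normE /ball_ /= -emb_nrm -(rpartK_ge0 (ltW e0)) ltr_emb nrmB.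
  rewrite -(subnKC nm); apply: le_lt_trans (solD _ _) _.
  apply: le_lt_trans (proj1 (hn n (leqnn n))).
  by rewrite ler_wpM2l // gerBl exprn_ge0.
move=> /cvg_ex[/= v hv]; exists v; apply/eqP; rewrite eq_sym -subr_eq0.
apply/eqP/nrm0_eq0/eqP; rewrite eq_le nrm_ge0 andbT.
apply/ler_addgt0Pr => e e0; rewrite add0r.
have e2 : 0 < e / 2 by rewrite divr_gt0.
have [n hn] := small _ e2.
have d0 : 0 < emb s (e / 2 / B) by rewrite -(emb0 R s) ltr_emb divr_gt0.
move/cvgrPdist_lt : hv => /(_ _ d0) [n' _ hn'].
have {hn'}h1 := hn' _ (leq_maxr n n').
have [_ h2] := hn _ (leq_maxl n n').
have -> : y - S v = res (maxn n n') - S (v - sol (maxn n n')).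
  by rewrite -solE -scaleN1r frame_opD -[- sol _]scaleN1r frame_opZ scaleN1r
    scaleN1r opprB addrA subrK.
apply: le_trans (ler_nrmD _ _) _; rewrite nrmN [e]splitr lerD //.
  by apply: le_trans (resE _) (ltW h2).
apply: le_trans (frame_op_bounded _) _; rewrite mulrC -ler_pdivlMr //.
by rewrite -(ler_emb s) emb_nrm ltW.
Qed.

Lemma frame_op_dual i : S (dual_frame dot g i) = g i.
Proof.
rewrite /dual_frame; apply: pinvK; rewrite inE.
by have [x hx] := frame_op_surjective (g i); exists x.
Qed.

(** Writing [x = S z], the expansion of [<S z, y>] has coefficients
    [<z, g i> = <z, S (S^-1 (g i))> = <x, S^-1 (g i)>]. *)
Lemma dual_frame_dot_le x y :
  ((nrm (dot x y))%:E <= \esum_(i in [set: X])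
    (nrm (dot x (dual_frame dot g i)) * nrm (dot (g i) y))%:E)%E.
Proof.
have [z <-] := frame_op_surjective x.
apply: le_trans (frame_op_dot_le _ _) _; apply: le_esum => i _.
by rewrite frame_op_selfadjoint frame_op_dual.
Qed.

End FrameOperator.

Section RieszBasis.
Variables (R : realType) (s : scalars).
Local Notation K := (scalar_field R s).
Variables (H : completeNormedModType K) (dot : {dot H for sconj s}).
Hypothesis hdot : forall h : H, dot h h = `|h| ^+ 2.
Variables (X : choiceType) (g : X -> H) (A B : R).
Hypothesis hg : riesz_basis g A B.

Lemma riesz_fset (F : {fset X}) (b : X -> K) :
  let v := \sum_(i <- F) b i *: g i in
  A * \sum_(i <- F) nrm (b i) ^+ 2 <= nrm v ^+ 2 /\
  nrm v ^+ 2 <= B * \sum_(i <- F) nrm (b i) ^+ 2.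
Proof.
move=> v; case: hg => -[A0 AB hR] _.
(* The Riesz bounds speak of square summable families: extend [b] by zero. *)
pose b' i := if i \in F then b i else 0.
have b'E : sqsum setT b' = (\sum_(i <- F) nrm (b i) ^+ 2)%:E.
  rewrite (_ : \sum_(i <- F) _ = \sum_(i <- F) nrm (b' i) ^+ 2); last first.
    by rewrite big_seq [RHS]big_seq; apply: eq_bigr => i iF; rewrite /b' iF.
  apply/eqP; rewrite eq_le sqsum_fset_le ?andbT //.
  apply: esum_le_fset => F' _; rewrite sumEFin lee_fin.
  rewrite (big_fsetID _ (mem F)) /= [X in _ + X]big1_fset ?addr0; last first.
    by move=> i; rewrite !inE => /andP[_ /negbTE iF] _; rewrite /b' iF nrm0 expr0n.
  rewrite [leRHS](big_fsetID _ (mem F')) /=.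
  have -> : [fset x in F' | x \in F]%fset = [fset x in F | x \in F']%fset.
    by apply/fsetP => i; rewrite !inE andbC.
  by rewrite lerDl sumr_ge0 // => i _; exact: sqr_ge0.
have [|w [hw]] := hR b'; first by rewrite b'E ltry.
have -> : w = v.
  apply: has_sum_unique hw _; apply/has_sumP => e e0; exists F => F' FF'.
  rewrite (_ : _ - _ = 0) ?nrm0 //; apply/eqP; rewrite subr_eq0; apply/eqP.
  rewrite /partial_sum (eq_bigl xpredT); last by move=> i; rewrite in_setT.
  rewrite -(big_fset_incl _ FF'); last first.
    by move=> i _ iF; rewrite /b' (negbTE iF) scale0r.
  by rewrite /v big_seq [RHS]big_seq; apply: eq_bigr => i iF; rewrite /b' iF.
by rewrite b'E -!EFinM !lee_fin.
Qed.

(** Pairing [h] with the synthesis of its own coefficients bounds their square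
    sum [q] by [sqrt (B q) |h|]. *)
Lemma riesz_bessel_fset (h : H) (F : {fset X}) :
  \sum_(i <- F) nrm (dot h (g i)) ^+ 2 <= B * nrm h ^+ 2.
Proof.
have B0 : 0 < B by case: hg => -[A0 /(lt_le_trans A0)].
pose v := \sum_(i <- F) dot h (g i) *: g i.
have [_ hv] := @riesz_fset F (fun i => dot h (g i)); rewrite -/v /= in hv.
have h1 : \sum_(i <- F) nrm (dot h (g i)) ^+ 2 <= nrm v * nrm h.
  have -> : \sum_(i <- F) nrm (dot h (g i)) ^+ 2 = rpart (dot v h).
    rewrite /v dot_suml rpart_sum; apply: eq_bigr => i _.
    by rewrite dotZl [dot (g i) h]dotC mul_sconj embK.
  apply: le_trans (ler_norm _) _; apply: le_trans (ler_nrm_rpart _) _.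
  exact: cauchy_schwarz.
move: h1 hv; set q := \sum_(i <- F) _; move: (nrm v) (nrm h) => p r h1 hv.
have : 0 <= (p - B * r) ^+ 2 by exact: sqr_ge0.
have : B * q <= B * (p * r) by rewrite ler_wpM2l ?(ltW B0).
rewrite (_ : (p - B * r) ^+ 2 = p ^+ 2 - 2 * (B * (p * r)) + B * (B * r ^+ 2)); last by ring.
move=> h2 h3; rewrite -(ler_pM2l B0); lra.
Qed.

Lemma riesz_bessel : bessel_bound dot g B.
Proof.
move=> h; apply: esum_le_fset => F _.
by rewrite sumEFin lee_fin riesz_bessel_fset.
Qed.

(** On the linear span the lower Riesz bound dualizes to the lower frame bound,
    and a vector within distance [t] of the span satisfies the latter up to an
    error of order [t]. *)
Lemma riesz_frame : frame_bounds dot g A B.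
Proof.
case: (hg) => -[A0 AB _] hd; split=> //; first exact: riesz_bessel.
have B0 : 0 < B := lt_le_trans A0 AB.
move=> h; have := riesz_bessel h; case sqE : (sqsum _ _) => [q| |] //; last first.
  have : (0%:E <= sqsum setT (fun i => dot h (g i)))%E.
    by apply: esum_ge0 => i _; rewrite lee_fin sqr_ge0.
  by rewrite sqE.
move=> _; rewrite lee_fin.
have q0 : 0 <= q.
  by rewrite -lee_fin -sqE; apply: esum_ge0 => i _; rewrite lee_fin sqr_ge0.
have key t : 0 < t <= 1 -> A * nrm h ^+ 2 <= q + t * (3 * q + 4 * B + 2 * A).
  move=> /andP[t0 t1]; have et0 : 0 < emb s t by rewrite -(emb0 R s) ltr_emb.
  have [||v []] := hd (ball h (emb s t)).
  - by exists h; exact: ballxx.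
  - exact: ball_open.
  rewrite -ball_normE /ball_ /= -emb_nrm ltr_emb => hv [F [b vE]].
  have h1 : A * nrm v ^+ 2 <= \sum_(i <- F) nrm (dot v (g i)) ^+ 2.
    have [hl _] := @riesz_fset F b; rewrite /= -vE in hl.
    have h1 := nrm_sqr_synthesis hdot vE.
    have h2 := sum_mul_amgm F (fun i => nrm (b i)) (fun i => nrm (dot v (g i))) A0.
    have := le_trans h1 h2; rewrite ler_pdivlMr // => h3.
    by rewrite -ler_pdivlMl //; move: hl h3; lra.
  have h2 : \sum_(i <- F) nrm (dot v (g i)) ^+ 2 <=
      (1 + t) * q + (1 + t^-1) * (B * nrm (v - h) ^+ 2).
    apply: (@le_trans _ _ (\sum_(i <- F) ((1 + t) * nrm (dot h (g i)) ^+ 2 +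
        (1 + t^-1) * nrm (dot (v - h) (g i)) ^+ 2))).
      apply: ler_sum => i _; rewrite -[X in dot X _](subrKC h v) dotDl.
      exact: nrm_sqrD_le.
    rewrite big_split /= -!mulr_sumr lerD // ler_wpM2l ?riesz_bessel_fset //.
    - by lra.
    - by rewrite -lee_fin -sqE; apply: (sqsum_fset_le (fun i => dot h (g i))).
    - by rewrite addr_ge0 // invr_ge0 ltW.
  have h3 := nrm_sqrD_le t0 v (h - v); rewrite subrKC in h3.
  have dt : (1 + t^-1) * nrm (h - v) ^+ 2 <= t ^+ 2 + t.
    have -> : t ^+ 2 + t = (1 + t^-1) * t ^+ 2 by field; rewrite gt_eqF.
    rewrite ler_wpM2l ?addr_ge0 ?invr_ge0 ?(ltW t0) //.
    by rewrite ler_pXn2r ?nnegrE ?nrm_ge0 ?ltW.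
  rewrite [nrm (v - h)]nrmB in h2.
  have {}h2 : A * nrm v ^+ 2 <= (1 + t) * q + B * (t ^+ 2 + t).
    apply: le_trans h1 _; apply: le_trans h2 _; rewrite lerD2l mulrCA.
    by rewrite ler_wpM2l // ltW.
  have {}h3 : A * nrm h ^+ 2 <= (1 + t) * (A * nrm v ^+ 2) + A * (t ^+ 2 + t).
    rewrite [X in _ <= X + _]mulrCA -mulrDr ler_wpM2l ?(ltW A0) //; apply: le_trans h3 _.
    by rewrite lerD2l.
  have t2 : t ^+ 2 <= t by rewrite expr2 ler_piMl // ltW.
  have {}h2 : A * nrm v ^+ 2 <= (1 + t) * q + B * (2 * t).
    by apply: le_trans h2 _; rewrite lerD2l ler_wpM2l ?(ltW B0) //; lra.
  have h4 : (1 + t) * (A * nrm v ^+ 2) <= (1 + t) * ((1 + t) * q + B * (2 * t)).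
    by rewrite ler_wpM2l // addr_ge0 // ltW.
  have h5 : A * (t ^+ 2 + t) <= A * (2 * t) by rewrite ler_wpM2l ?(ltW A0) //; lra.
  apply: le_trans h3 _; apply: le_trans (lerD h4 h5) _.
  have h6 : t ^+ 2 * q <= t * q by rewrite ler_wpM2r.
  have h7 : t ^+ 2 * B <= t * B by rewrite ler_wpM2r // ltW.
  rewrite [leLHS](_ : _ = q + 2 * (t * q) + t ^+ 2 * q + 2 * (t * B)
     + 2 * (t ^+ 2 * B) + 2 * (t * A)); last by ring.
  by rewrite [X in _ <= _ + X](_ : _ = 3 * (t * q) + 4 * (t * B) + 2 * (t * A));
    [lra|ring].
apply/ler_addgt0Pr => e e0; set C := 3 * q + 4 * B + 2 * A in key.
have C0 : 0 < C by rewrite /C; lra.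
have t01 : 0 < Num.min 1 (e / C) <= 1.
  by rewrite lt_min ltr01 divr_gt0 // ge_min lexx.
apply: le_trans (key _ t01) _; rewrite lerD2l -ler_pdivlMr //.
by rewrite ge_min lexx orbT.
Qed.

End RieszBasis.

(** * Matrices dominated by summable sequences *)

Section EsumTools.
Variable R : realType.
Local Open Scope ereal_scope.

Lemma esum_mull_le (X : choiceType) (J : set X) (k : \bar R) (t : X -> \bar R) :
  0 <= k -> (forall i, 0 <= t i) ->
  \esum_(i in J) (k * t i) <= k * \esum_(i in J) t i.
Proof.
move=> k0 t0; apply: esum_le_fset => A AJ; rewrite -ge0_sume_distrr //.
by rewrite lee_wpmul2l // esum_fset_le.
Qed.

Lemma exchange_esum (X Y : choiceType) (t : X -> Y -> \bar R) :
  (forall x y, 0 <= t x y) ->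
  \esum_(x in [set: X]) \esum_(y in [set: Y]) t x y =
  \esum_(y in [set: Y]) \esum_(x in [set: X]) t x y.
Proof.
move=> t0; rewrite !esum_esum //.
rewrite (reindex_esum ([set: Y] `*`` fun=> [set: X]) _ (fun z => (z.2, z.1))) //.
split=> [//||]; first by move=> [y x] [y' x'] _ _ /= [-> ->].
by move=> [x y] _; exists (y, x).
Qed.

Lemma reindex_esumT (X : choiceType) (h h' : X -> X) (t : X -> \bar R) :
  cancel h h' -> cancel h' h ->
  \esum_(x in [set: X]) t (h x) = \esum_(x in [set: X]) t x.
Proof.
move=> hK h'K; rewrite -(reindex_esum [set: X] [set: X] h) //.
by split=> [//|x y _ _ /(can_inj hK)|x _] //; exists (h' x).
Qed.

End EsumTools.

Section EllOneDominated.
Variables (R : realType) (G : zmodType).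

Definition ell1_dominated (Y Z : Type) (al : Y -> G) (be : Z -> G)
    (m : Y -> Z -> R) : Prop :=
  exists p : G -> R, [/\ forall x, 0 <= p x,
    (\esum_(x in [set: G]) (p x)%:E < +oo)%E &
    forall y z, m y z <= p (al y - be z)].

Lemma ell1_dominated_sym (Y Z : Type) (al : Y -> G) (be : Z -> G) m m' :
  ell1_dominated al be m -> (forall y z, m' z y = m y z) ->
  ell1_dominated be al m'.
Proof.
move=> [p [p0 pfin mp]] mm'; exists (fun x => p (- x)); split=> //.
  by rewrite (reindex_esumT (fun x => (p x)%:E) (@opprK G) (@opprK G)).
by move=> z y; rewrite opprB mm'.
Qed.

(** Convolution of the dominating sequences: this is why matrices dominated by
    summable sequences are closed under multiplication. *)
Lemma ell1_dominated_mul (Y Z : Type) (al : Y -> G) (be : Z -> G) m1 m2 m :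
  ell1_dominated al id m1 -> ell1_dominated id be m2 ->
  (forall y k, 0 <= m1 y k) -> (forall k z, 0 <= m2 k z) ->
  (forall y z, ((m y z)%:E <= \esum_(k in [set: G]) (m1 y k * m2 k z)%:E)%E) ->
  ell1_dominated al be m.
Proof.
move=> [p [p0 pfin mp]] [q [q0 qfin mq]] m10 m20 mle.
pose c x := (\esum_(k in [set: G]) (p (x - k) * q k)%:E)%E.
have c0 x : (0 <= c x)%E.
  by apply: esum_ge0 => k _; rewrite lee_fin mulr_ge0.
have cfin : (\esum_(x in [set: G]) c x < +oo)%E.
  rewrite exchange_esum; last by move=> x k; rewrite lee_fin mulr_ge0.
  apply: (@le_lt_trans _ _ (\esum_(k in [set: G])
      ((\esum_(x in [set: G]) (p x)%:E) * (q k)%:E))%E).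
    apply: le_esum => k _.
    rewrite -(reindex_esumT (fun x => (p x)%:E) (subrK k) (addrK k)).
    rewrite muleC; apply: le_trans (esum_mull_le _ _ _); rewrite ?lee_fin //.
    - by apply: le_esum => x _; rewrite -EFinM mulrC.
    - by move=> x; rewrite lee_fin.
  apply: le_lt_trans (esum_mull_le _ _ _) _.
  - by apply: esum_ge0 => x _; rewrite lee_fin.
  - by move=> x; rewrite lee_fin.
  - apply: lte_mul_pinfty => //; first by apply: esum_ge0 => x _; rewrite lee_fin.
    by rewrite ge0_fin_numE //; apply: esum_ge0 => x _; rewrite lee_fin.
have cnum x : c x \is a fin_num.
  rewrite ge0_fin_numE //; apply: le_lt_trans cfin.
  have := esum_fset_le (J := setT) (A := [fset x]%fset) c0.
  by rewrite big_seq_fset1; apply.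
exists (fun x => fine (c x)); split.
- by move=> x; rewrite fine_ge0.
- by under eq_esum do rewrite fineK //.
move=> y z; rewrite -lee_fin fineK //; apply: le_trans (mle y z) _.
rewrite /c -(reindex_esumT (fun k => (p (al y - be z - k) * q k)%:E)
  (subrK (be z)) (addrK (be z))).
apply: le_esum => k _; rewrite lee_fin opprB addrA subrK.
by apply: ler_pM.
Qed.

Lemma sum_pullback_le (I : choiceType) (a : I -> G) (M : nat) (t : G -> R) (C : R)
    (h : G -> G) (A : {fset I}) : injective h ->
  (forall x, 0 <= t x) -> (forall F : {fset G}, \sum_(x <- F) t x <= C) ->
  (forall y (F : {fset I}), (forall i, i \in F -> a i = y) -> (#|` F| <= M)%N) ->
  \sum_(i <- A) t (h (a i)) <= M%:R * C.
Proof.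
move=> hinj t0 tC aM.
rewrite (partition_big_imfset _ a) /=.
apply: (@le_trans _ _ (\sum_(y <- [fset a i | i in A]%fset) M%:R * t (h y))).
  apply: ler_sum => y _; rewrite big_fset_condE /=.
  rewrite (eq_big_seq (fun=> t (h y))); last first.
    by move=> i; rewrite !inE => /andP[_ /eqP ->].
  rewrite big_const_seq count_predT iter_addr_0 mulrC -[leLHS]mulr_natr.
  rewrite ler_wpM2l // ler_nat; apply: (aM y) => i.
  by rewrite !inE => /andP[_ /eqP].
rewrite -mulr_sumr ler_wpM2l //.
set F := [fset a i | i in A]%fset.
have -> : \sum_(y <- F) t (h y) = \sum_(x <- [fset h y | y in F]%fset) t x.
  by rewrite [RHS]big_imfset //= => x y _ _; exact: hinj.
exact: tC.
Qed.

End EllOneDominated.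

(** * Restricted invertibility for finite subfamilies *)

Section FsetImage.
Variables (I : finType) (X : choiceType) (h : I -> X).
Hypothesis hinj : injective h.

Lemma big_fset_of_finset (T : Type) (idx : T) (op : Monoid.com_law idx)
    (F : {set I}) (E : X -> T) :
  \big[op/idx]_(x <- [fset h i | i in F]%fset) E x =
  \big[op/idx]_(i in F) E (h i).
Proof.
rewrite big_imfset /=; last by move=> i j _ _ /hinj.
by rewrite big_enum.
Qed.

Lemma card_fset_of_finset (F : {set I}) : #|` [fset h i | i in F]%fset| = #|F|.
Proof. by rewrite card_imfset //= -cardE. Qed.

End FsetImage.

Lemma bessel_gt0 (R : realType) (s : scalars)
    (H : completeNormedModType (scalar_field R s)) (dot : {dot H for sconj s})
    (hdot : forall h : H, dot h h = `|h| ^+ 2)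
    (X : choiceType) (f : X -> H) (BF : R) (i : X) :
  bessel_bound dot f BF -> 0 < nrm (f i) -> 0 < BF.
Proof.
move=> hf fi; have := bessel_fset (f i) [fset i]%fset hf.
rewrite big_seq_fset1 (nrm_dot_diag hdot) -(@pmulr_lgt0 _ (nrm (f i) ^+ 2)) ?exprn_gt0 //.
by apply: lt_le_trans; rewrite !exprn_gt0.
Qed.

Section FiniteSubfamily.
Variables (R : realType) (s : scalars).
Local Notation K := (scalar_field R s).
Variables (H : completeNormedModType K) (dot : {dot H for sconj s}).
Hypothesis hdot : forall h : H, dot h h = `|h| ^+ 2.

(** Some [e j] may vanish, so that there are exactly [n] of them even when the
    family is dependent; the second property covers both cases. *)
Lemma gram_schmidt (f : nat -> H) (n : nat) : exists e : nat -> H,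
  [/\ forall i j, (i < n)%N -> (j < n)%N -> i != j -> dot (e i) (e j) = 0,
      forall j x, (j < n)%N -> dot x (e j) * dot (e j) (e j) = dot x (e j) &
      forall i, (i < n)%N -> f i = \sum_(j < n) dot (f i) (e j) *: e j].
Proof.
elim: n => [|n [e [eo en ee]]]; first by exists (fun=> 0).
pose h := f n - \sum_(j < n) dot (f n) (e j) *: e j.
have he j : (j < n)%N -> dot h (e j) = 0.
  move=> jn; rewrite /h dotBl dot_suml (bigD1 (Ordinal jn)) //= big1 => [|i ij].
    by rewrite addr0 dotZl en // subrr.
  by rewrite dotZl eo ?mulr0.
have eh j : (j < n)%N -> dot (e j) h = 0 by move=> /he jh; rewrite dotC jh sconj0.
pose k := emb s (nrm h)^-1.
pose e' i := if i == n then k *: h else e i.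
have e'n : e' n = k *: h by rewrite /e' eqxx.
have e'lt i : (i < n)%N -> e' i = e i by rewrite /e' => /ltn_eqF->.
have kh : k * k * dot h h * k = k.
  rewrite (dot_emb hdot) -!embM; congr emb.
  by have [->|h0] := eqVneq (nrm h) 0; [rewrite invr0 !mulr0|field].
have fh : dot (f n) h = dot h h.
  rewrite -[X in dot X _](subrK (\sum_(j < n) dot (f n) (e j) *: e j)) -/h dotDl.
  rewrite dot_suml big1 ?addr0 // => j _; by rewrite dotZl eh ?mulr0.
have kk : sconj s k = k by exact: sconj_emb.
exists e'; split.
- move=> i j; rewrite 2!ltnS (leq_eqVlt i) (leq_eqVlt j) => /orP[/eqP->|lin] /orP[/eqP->|ljn] ij.
  + by rewrite eqxx in ij.
  + by rewrite e'n e'lt // dotZl he ?mulr0.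
  + by rewrite e'n e'lt // dotZr eh ?mulr0.
  + by rewrite !e'lt // eo.
- move=> j x; rewrite ltnS leq_eqVlt => /orP[/eqP->|ljn]; last by rewrite e'lt ?en.
  rewrite e'n !dotZr dotZl kk mulrC -[in RHS]kh.
  by rewrite !mulrA.
move=> i; rewrite ltnS big_ord_recr /= e'n dotZr kk.
have eqs : \sum_(j < n) dot (f i) (e' j) *: e' j = \sum_(j < n) dot (f i) (e j) *: e j.
  by apply: eq_bigr => j _; rewrite e'lt.
rewrite eqs leq_eqVlt => /orP[/eqP->|lin]; last first.
  rewrite -ee // [X in dot X h](ee _ lin) dot_suml big1 ?mulr0 ?scale0r ?addr0 //.
  by move=> j _; rewrite dotZl eh ?mulr0.
rewrite fh scalerA.
have -> : (k * dot h h * k) *: h = h.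
  have [->|h0] := eqVneq h 0; first by rewrite scaler0.
  rewrite (dot_emb hdot) -!embM.
  have h0' : nrm h != 0 by apply: contra_neq h0 => /nrm0_eq0.
  rewrite (_ : (_ * _ * _)%R = 1) ?emb1 ?scale1r //; by field.
by rewrite /h addrC subrK.
Qed.

Lemma l2norm_ge0 (n : nat) (x : 'rV[K]_n) : 0 <= l2norm x.
Proof. exact: sqrtr_ge0. Qed.

Lemma l2norm_sqr (n : nat) (x : 'rV[K]_n) :
  l2norm x ^+ 2 = \sum_i nrm (x 0 i : K) ^+ 2.
Proof. by rewrite sqr_sqrtr // sumr_ge0 // => i _; exact: sqr_ge0. Qed.

Definition delta_basis (n : nat) : n.-tuple 'rV[K]_n :=
  [tuple (delta_mx 0 i : 'rV[K]_n) | i < n].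

Lemma delta_basis_orthonormal (n : nat) : @orthonormal_basis R s n (delta_basis n).
Proof.
split.
  rewrite basisEdim size_tuple dimvf /dim /= mul1n leqnn andbT.
  apply/subvP => v _; rewrite (row_sum_delta v); apply: memv_suml => i _.
  apply/memvZ/memv_span.
  have <- : tnth (delta_basis n) i = delta_mx 0 i by rewrite tnth_mktuple.
  exact: mem_tnth.
move=> i j; rewrite !tnth_mktuple /l2dot (bigD1 i) //= big1 => [|k ki].
  rewrite !mxE !eqxx addr0 mul1r /=; case: (i == j); last exact: sconj0.
  by rewrite -(emb1 R s) sconj_emb.
by rewrite !mxE (negbTE ki) mul0r.
Qed.

(** The restricted invertibility of matrices transfers to a finite subfamily of
    a Bessel family in [H]: in Gram-Schmidt coordinates the family becomes the
    image of the standard basis under an operator of norm at most [sqrt BF]. *)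
Lemma finite_subfamily (c : R -> R) (X : choiceType) (f : X -> H) (BF u eps : R)
    (A : {fset X}) :
  finite_restricted_invertibility s c -> bessel_bound dot f BF -> 0 < u ->
  (forall i, u <= nrm (f i)) -> 0 < eps < 1 -> A != fset0 ->
  exists J : {fset X}, [/\ (J `<=` A)%fset,
    (1 - eps) * u ^+ 2 / BF * #|` A|%:R <= #|` J|%:R &
    forall b : X -> K, c eps * u ^+ 2 * \sum_(i <- J) nrm (b i) ^+ 2 <=
      nrm (\sum_(i <- J) b i *: f i) ^+ 2].
Proof.
move=> [_ _ _ hc] hf u0 hu heps A0; case/fset0Pn: (A0) => x0 x0A.
pose n := #|` A|; have n0 : (0 < n)%N by rewrite cardfs_gt0.
pose phi (i : 'I_n) := nth x0 (enum_fset A) i.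
have phiA (i : 'I_n) : phi i \in A by exact: mem_nth.
have phi_inj : injective phi.
  by move=> i j /eqP; rewrite nth_uniq ?fset_uniq // => /eqP /val_inj.
have [e [_ _ ee]] := gram_schmidt (fun i => f (nth x0 (enum_fset A) i)) n.
pose M : 'M[K]_n := \matrix_(i, j) dot (f (phi i)) (e j).
pose T : {linear 'rV[K]_n -> 'rV[K]_n} := mulmxr M.
pose syn (y : 'rV[K]_n) := \sum_(i < n) y 0 i *: f (phi i).
have TE y : l2norm (T y) ^+ 2 = nrm (syn y) ^+ 2.
  have hT j : (T y) 0 j = dot (syn y) (e j).
    rewrite /T /= mxE dot_suml; apply: eq_bigr => i _.
    by rewrite mxE dotZl.
  have hs : syn y = \sum_(j < n) dot (syn y) (e j) *: e j.
    rewrite {1}/syn; under eq_bigr => i _ do rewrite (ee i (ltn_ord i)) scaler_sumr.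
    rewrite exchange_big /=; apply: eq_bigr => j _.
    rewrite dot_suml scaler_suml; apply: eq_bigr => i _.
    by rewrite dotZl scalerA.
  rewrite l2norm_sqr (nrm_sqrE hdot) [X in dot X _]hs dot_suml rpart_sum.
  apply: eq_bigr => j _.
  by rewrite hT dotZl [dot (e j) _]dotC mul_sconj embK.
have syn_set (F : {set 'I_n}) (b : X -> K) :
    syn (\sum_(i in F) b (phi i) *: delta_mx 0 i) =
    \sum_(x <- [fset phi i | i in F]%fset) b x *: f x.
  rewrite big_fset_of_finset // /syn [RHS]big_mkcond /=; apply: eq_bigr => i _.
  rewrite summxE; under eq_bigr do rewrite !mxE /=.
  case: ifPn => iF; last first.
    rewrite big1 ?scale0r // => j jF; case: eqP => [ij|]; last by rewrite mulr0.
    by rewrite ij jF in iF.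
  rewrite (bigD1 i) //= eqxx mulr1 big1 ?addr0 // => j /andP[_ ji].
  by rewrite eq_sym (negbTE ji) mulr0.
have uT i : u <= l2norm (T (tnth (delta_basis n) i)).
  rewrite -(@ler_pXn2r _ 2) ?nnegrE ?l2norm_ge0 ?(ltW u0) // TE.
  rewrite ler_pXn2r ?nnegrE ?nrm_ge0 ?(ltW u0) //.
  rewrite /syn (bigD1 i) //= big1 => [|j ji]; rewrite tnth_mktuple mxE.
    by rewrite !eqxx scale1r addr0.
  by rewrite (negbTE ji) scale0r.
have BF0 : 0 < BF.
  by apply: (bessel_gt0 hdot (i := x0) hf); apply: lt_le_trans (hu x0).
have TB y : l2norm y <= 1 -> l2norm (T y) <= Num.sqrt BF.
  move=> y1; rewrite -(@ler_pXn2r _ 2) ?nnegrE ?l2norm_ge0 ?sqrtr_ge0 // TE.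
  rewrite sqr_sqrtr ?(ltW BF0) //.
  pose b x := if [pick i | phi i == x] is Some i then y 0 i else 0.
  have bphi i : b (phi i) = y 0 i.
    by rewrite /b; case: pickP => [j /eqP/phi_inj->|/(_ i)/eqP].
  have -> : syn y = \sum_(x <- [fset phi i | i in [set: 'I_n]%SET]%fset) b x *: f x.
    rewrite big_fset_of_finset // /syn; apply: eq_big => [i|i _]; first by rewrite inE.
    by rewrite bphi.
  apply: le_trans (bessel_synthesis hdot _ _ BF0 hf) _.
  rewrite big_fset_of_finset // ger_pMr // (eq_bigl xpredT); last by move=> i; rewrite inE.
  under eq_bigr do rewrite bphi.
  by rewrite -l2norm_sqr expr_le1 ?l2norm_ge0.
have delta1 i : l2norm (tnth (delta_basis n) i) <= 1.
  rewrite -(@ler_pXn2r _ 2) ?nnegrE ?l2norm_ge0 // l2norm_sqr expr1n.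
  rewrite (bigD1 i) //= big1 => [|j ji]; rewrite tnth_mktuple mxE.
    by rewrite !eqxx addr0 -(emb1 R s) nrm_emb normr1 expr1n.
  by rewrite (negbTE ji) andbF nrm0 expr0n.
have opub : has_ubound [set l2norm (T x) | x in [set x | l2norm x <= 1]].
  by exists (Num.sqrt BF) => _ [y /= /TB yB <-].
have opu : u <= opnorm T.
  apply: le_trans (uT (Ordinal n0)) _; apply: ub_le_sup => //.
  by exists (tnth (delta_basis n) (Ordinal n0)) => //=; exact: delta1.
have opB : opnorm T <= Num.sqrt BF.
  apply: ge_sup => [|_ [y /= /TB yB <-] //].
  by exists (l2norm (T (tnth (delta_basis n) (Ordinal n0))));
    exists (tnth (delta_basis n) (Ordinal n0)) => //=; exact: delta1.
have [J [Jn Jb]] := hc eps n u (delta_basis n) T heps n0 u0 (delta_basis_orthonormal n) uT.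
exists [fset phi i | i in J]%fset; split.
- by apply/fsubsetP => x /imfsetP[i /= _ ->].
- rewrite card_fset_of_finset // -ler_pdivlMr ?ltr0n //; apply: le_trans _ Jn.
  have op0 : 0 < opnorm T by exact: lt_le_trans opu.
  rewrite ler_pM2l ?mulr_gt0 ?exprn_gt0 ?subr_gt0 //; last by case/andP: heps.
  rewrite lef_pV2 ?posrE ?exprn_gt0 // -[leRHS]sqr_sqrtr ?(ltW BF0) //.
  by rewrite ler_pXn2r ?nnegrE ?sqrtr_ge0 ?(ltW op0).
move=> b; have := Jb (fun i => b (phi i)).
rewrite big_fset_of_finset //= -(syn_set J b) -TE linear_sum /=.
congr (_ <= l2norm _ ^+ 2); apply: eq_bigr => i _.
by rewrite tnth_mktuple -scalemxAl.
Qed.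

End FiniteSubfamily.

(** * Cubes and tilings of the group *)

Section CubeVolume.
Variable R : realType.

Lemma bernoulli_le (x : R) (d : nat) : 0 <= x <= 1 -> 1 - d%:R * x <= (1 - x) ^+ d.
Proof.
move=> /andP[x0 x1]; elim: d => [|d ih]; first by rewrite mul0r subr0 expr0.
have x1' : 0 <= 1 - x by rewrite subr_ge0.
have h : 0 <= d%:R * x ^+ 2 by rewrite mulr_ge0 ?sqr_ge0.
have := ler_wpM2l x1' ih; rewrite -exprS; apply: le_trans.
rewrite -[d.+1]addn1 natrD; move: h; rewrite expr2; move: (d%:R : R) => D.
by nra.
Qed.

(** By Bernoulli's inequality the ratio of the two volumes is at least
    [1 - 2 s d / (2 (n + s) + 1)]: the boundary layer of a large cube is negligible. *)
Lemma cube_volume_ratio (T d s : nat) (th : R) : th < 1 ->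
  exists n0, forall n, (n0 <= n)%N ->
    th * ((2 * (n + s) + 1) ^ d * T)%N%:R <= ((2 * n + 1) ^ d * T)%N%:R.
Proof.
move=> th1; have t0 : 0 < 1 - th by rewrite subr_gt0.
exists (Num.truncn (d%:R * (2 * s)%:R / (1 - th))).+1 => n.
rewrite truncn_lt_nat ?divr_ge0 ?mulr_ge0 ?(ltW t0) //.
rewrite ltr_pdivrMr // => hn; rewrite !natrM mulrA ler_wpM2r // !natrX.
have D0 : 0 < (2 * (n + s) + 1)%N%:R :> R by rewrite ltr0n addn1.
have -> : (2 * n + 1)%N%:R =
    (1 - (2 * s)%N%:R / (2 * (n + s) + 1)%N%:R) * (2 * (n + s) + 1)%N%:R :> R.
  rewrite mulrBl mul1r divfK ?gt_eqF // -natrB; last by lia.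
  by congr (_%:R); lia.
rewrite exprMn ler_pM2r ?exprn_gt0 //; apply: le_trans (bernoulli_le _ _); last first.
  by rewrite divr_ge0 //= ler_pdivrMr // mul1r ler_nat; lia.
rewrite lerBrDr -lerBrDl mulrA ler_pdivrMr //.
apply: le_trans (ltW hn) _; rewrite mulrC ler_wpM2l ?(ltW t0) // ler_nat; lia.
Qed.

End CubeVolume.

Section Balls.
Variables (d1 d2 : nat) (N : 'I_d2 -> nat).
Local Notation Z := {ffun 'I_d1 -> int}.
Local Notation G := (fgroup d1 N).
Local Notation Nmax := (\max_(j < d2) N j)%N.

Let cube_point (n : nat) (k : Z) (y : {ffun 'I_d1 -> 'I_(2 * n + 1)} * torsion N) : G :=
  ([ffun j => (y.1 j : nat)%:Z - n%:Z + k j], y.2).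

(** The points whose free part lies in the cube of radius [n] around [k], with
    arbitrary torsion part; this is the ball as soon as [n] bounds the torsion
    coordinates. *)
Definition cube (n : nat) (k : Z) : {fset G} :=
  [fset cube_point k y | y in [set: {ffun 'I_d1 -> 'I_(2 * n + 1)} * torsion N]%SET]%fset.

Lemma mem_cube n (k : Z) (x : G) :
  reflect (forall j, (`|(x.1 j - k j)%R| <= n)%N) (x \in cube n k).
Proof.
have shift_lt (u v : int) : (`|u - v| <= n)%N -> (`|(u - v + n%:Z)%R| < 2 * n + 1)%N by lia.
have shiftK (u v : int) : (`|u - v| <= n)%N -> u = (`|(u - v + n%:Z)%R|%N%:Z - n%:Z + v)%R by lia.
apply: (iffP idP) => [/imfsetP[y /= _ ->] j|h].
  by rewrite /cube_point ffunE addrK; have := ltn_ord (y.1 j); move: (nat_of_ord _) => v; lia.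
pose y : {ffun 'I_d1 -> 'I_(2 * n + 1)} := [ffun j => Ordinal (shift_lt _ _ (h j))].
apply/imfsetP; exists (y, x.2); first by rewrite /= inE.
rewrite [x in LHS]surjective_pairing /cube_point /=; congr (_, _); apply/ffunP => j.
by rewrite !ffunE /=; exact: shiftK (h j).
Qed.

Lemma card_cube n k : #|` cube n k| = ((2 * n + 1) ^ d1 * #|torsion N|)%N.
Proof.
rewrite card_fset_of_finset; last first.
  move=> [y t] [y' t'] [/ffunP h <-]; congr (_, _); apply/ffunP => j.
  have := h j; rewrite !ffunE /= => /addIr/addIr [hj].
  exact: val_inj.
by rewrite cardsT card_prod card_ffun !card_ord.
Qed.

Lemma gdist_cube n (x k : G) : (Nmax <= n)%N -> (gdist x k <= n)%N = (x \in cube n k.1).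
Proof.
move=> Nn; rewrite /gdist geq_max; apply/andP/mem_cube => [[/bigmax_leqP h _] j|h].
  exact: h.
split; apply/bigmax_leqP => j _; first exact: h.
have hN : (N j <= n)%N by apply: leq_trans Nn; exact: (leq_bigmax (F := N)).
have := ltn_ord (x.2 j); have := ltn_ord (k.2 j).
move: (nat_of_ord (x.2 j)) (nat_of_ord (k.2 j)) => p q; lia.
Qed.

Lemma gball_cube (R : realType) (r : R) (k : G) : Nmax%:R <= r ->
  gball k r = [set` cube (Num.truncn r) k.1].
Proof.
move=> Nr; have r0 : 0 <= r by apply: le_trans Nr.
apply/seteqP; split=> x; rewrite /gball /= -gdist_cube ?truncn_ge_nat //.
Qed.

Lemma card_torsion_gt0 : (0 < #|torsion N|)%N.
Proof. by apply/card_gt0P; exists 0. Qed.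

Lemma card_cube_gt0 n k : (0 < #|` cube n k|)%N.
Proof. by rewrite card_cube muln_gt0 card_torsion_gt0 expn_gt0 addn1. Qed.

(** The shift by [r] makes the Euclidean quotient the index of the nearest point
    of the lattice [(2 r + 1) Z^d1], so that the fibres of [tile r] are cubes of
    radius [r] and tile the group. *)
Definition tile (r : nat) (x : G) : Z :=
  [ffun j => ((x.1 j + r%:Z) %/ (2 * r + 1)%:Z)%Z].
Definition center (r : nat) (z : Z) : Z := [ffun j => z j * (2 * r + 1)%:Z].

Lemma centerE r (z : Z) j : center r z j = (z j * (2 * r + 1)%:Z)%R.
Proof. by rewrite ffunE. Qed.

Lemma tile_cube r (z : Z) (x : G) : (tile r x == z) = (x \in cube r (center r z)).
Proof.
have d0 : ((2 * r + 1)%:Z != 0)%R by rewrite eqz_nat addn1.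
have fwd (u : int) : (`|(u - ((u + r%:Z) %/ (2 * r + 1)%:Z)%Z * (2 * r + 1)%:Z)%R| <= r)%N.
  have := divz_eq (u + r%:Z) (2 * r + 1)%:Z.
  have := modz_ge0 (u + r%:Z) d0.
  have : ((u + r%:Z) %% (2 * r + 1)%:Z < (2 * r + 1)%:Z)%Z by apply: ltz_pmod; lia.
  set q := (_ * (2 * r + 1)%:Z)%R; set m := (_ %% _)%Z; lia.
have bwd (u v : int) : (`|(u - v * (2 * r + 1)%:Z)%R| <= r)%N ->
    ((u + r%:Z) %/ (2 * r + 1)%:Z)%Z = v.
  move=> huv; have -> : (u + r%:Z)%R = (v * (2 * r + 1)%:Z + (u - v * (2 * r + 1)%:Z + r%:Z))%R.
    by rewrite addrA addrC [(_ + (u - _))%R]addrC subrK addrC.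
  rewrite divzMDl // divz_small ?addr0 //; move: huv; set q := (v * _)%R; lia.
apply/eqP/mem_cube => [<- j|h]; first by rewrite !ffunE; exact: fwd.
by apply/ffunP => j; rewrite ffunE; apply: bwd; have := h j; rewrite ffunE.
Qed.

End Balls.

Section FsetCounting.

Lemma card_bigfcup_const (X Y : choiceType) (F : X -> {fset Y}) (m : nat) (A : {fset X}) :
  (forall x x', x != x' -> [disjoint F x & F x']%fset) ->
  (forall x, #|` F x| = m) -> #|` (\bigcup_(x <- A) F x)%fset| = (#|` A| * m)%N.
Proof.
move=> dF cF; have cardE (Z : choiceType) (B : {fset Z}) : #|` B| = (\sum_(i <- B) 1)%N.
  by rewrite sum1_size.
rewrite cardE partition_disjoint_bigfcup; last by move=> x x' _ _; exact: dF.
under eq_bigr do rewrite -cardE cF.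
by rewrite big_const_seq count_predT iter_addn_0 mulnC.
Qed.

End FsetCounting.

(** * Densities of localization maps *)

Section LimitBounds.
Variable R : realType.
Implicit Types (f : R -> \bar R) (l : \bar R).
Local Open Scope ereal_scope.

Lemma limf_einf_ge f l : (\forall r \near +oo%R, l <= f r) ->
  l <= limf_einf f (pinfty_nbhs R).
Proof.
move=> h; rewrite limf_einfE; apply: le_trans (ereal_sup_ubound _); last first.
  by exists [set r | l <= f r].
by apply: le_ereal_inf_tmp => _ [r hr <-].
Qed.

Lemma limf_esup_le f l : (\forall r \near +oo%R, f r <= l) ->
  limf_esup f (pinfty_nbhs R) <= l.
Proof.
move=> h; rewrite limf_esupE; apply: le_trans (ereal_inf_lbound _) _.
  by exists [set r | f r <= l].
by apply: ge_ereal_sup => _ [r hr <-].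
Qed.

Lemma limf_einf_le_esup f g : (\forall r \near +oo%R, f r <= g r) ->
  limf_einf f (pinfty_nbhs R) <= limf_esup g (pinfty_nbhs R).
Proof.
move=> h; rewrite limf_einfE limf_esupE.
apply: ge_ereal_sup => _ [V VF <-]; apply: le_ereal_inf_tmp => _ [W WF <-].
have [r [[hr Vr] Wr]] := filter_ex (filterI (filterI h VF) WF).
apply: (@le_trans _ _ (f r)); first by apply: ereal_inf_lbound; exists r.
by apply: le_trans hr _; apply: ereal_sup_ubound; exists r.
Qed.

Lemma limf_einf_gt f l : l < limf_einf f (pinfty_nbhs R) ->
  \forall r \near +oo%R, l < f r.
Proof.
rewrite limf_einfE => /ereal_sup_gt[_ [V VF <-] hl].
apply: filterS VF => r Vr; apply: lt_le_trans hl _.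
by apply: ereal_inf_lbound; exists r.
Qed.

Lemma limf_esup_lt f l : limf_esup f (pinfty_nbhs R) < l ->
  \forall r \near +oo%R, f r < l.
Proof.
rewrite limf_esupE => /ereal_inf_lt[_ [V VF <-] hl].
apply: filterS VF => r Vr; apply: le_lt_trans hl.
by apply: ereal_sup_ubound; exists r.
Qed.

Lemma near_pinfty_nat (P : set R) : (\forall r \near +oo%R, P r) ->
  exists n0, forall n, (n0 <= n)%N -> P n%:R%R.
Proof.
move=> [M [_ hM]]; exists (Num.truncn M).+1 => -[//|n] hn; apply: hM.
by rewrite -truncn_le_nat.
Qed.

Lemma nat_near_pinfty (n0 : nat) :
  \forall r \near (+oo%R : set_system R), (n0%:R <= r)%R /\ (n0 <= Num.truncn r)%N.
Proof.
exists n0%:R%R; split; first exact: num_real.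
move=> r /ltW hr; split=> //; rewrite truncn_ge_nat //.
by apply: le_trans hr.
Qed.

End LimitBounds.

Section DensityOfMaps.
Variables (R : realType) (d1 d2 : nat) (N : 'I_d2 -> nat).
Local Notation Z := {ffun 'I_d1 -> int}.
Local Notation G := (fgroup d1 N).
Local Notation Nmax := (\max_(j < d2) N j)%N.
Variables (I : choiceType) (a : I -> G).
Local Notation vol n := (((2 * n + 1) ^ d1 * #|torsion N|)%N%:R : R).
Local Notation over F := (a @^-1` [set` F]).

Lemma volume_gt0 n : 0 < vol n.
Proof. by have := @card_cube_gt0 d1 d2 N n 0; rewrite card_cube ltr0n. Qed.

Lemma counting_fset (X : choiceType) (F : {fset X}) :
  counting [set` F] = (#|` F|%:R)%:E :> \bar R.
Proof.
by rewrite /counting asboolT; [rewrite set_fsetK|exact: finite_fset].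
Qed.

Lemma ball_ratio_cube (J : set I) (r : R) (k : G) : Nmax%:R <= r ->
  ball_ratio a J r k =
  (counting (over (cube N (Num.truncn r) k.1) `&` J) * (vol (Num.truncn r))^-1%:E)%E.
Proof.
move=> Nr; rewrite /ball_ratio !gball_cube // counting_fset card_cube inver.
by rewrite gt_eqF // volume_gt0.
Qed.

Lemma ball_ratio_fset (J : set I) (F : {fset I}) (n : nat) (k : Z) (r : R) :
  Nmax%:R <= r -> Num.truncn r = n -> over (cube N n k) `&` J = [set` F] ->
  ball_ratio a J r (k, 0) = (#|` F|%:R / vol n)%:E.
Proof. by move=> Nr rn FE; rewrite ball_ratio_cube // rn FE counting_fset. Qed.

(** A finite upper density bounds the number of points over any single ball of
    some radius uniformly, hence the multiplicity of the map. *)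
Lemma upper_density_fibres : (upper_density R a setT < +oo)%E ->
  (forall F : {fset G}, finite_set (over F)) /\
  exists M : nat, forall y (F : {fset I}), (forall i, i \in F -> a i = y) ->
    (#|` F| <= M)%N.
Proof.
move=> hu; have [l lu] : exists l : R, (upper_density R a setT < l%:E)%E.
  move: hu; case: (upper_density _ _ _) => [l _| |_]; last by exists 0; rewrite ltNyr.
    by exists (l + 1); rewrite lte_fin ltrDl.
  by rewrite ltxx.
have [n0 hn0] := near_pinfty_nat (limf_esup_lt lu).
pose n := maxn n0 Nmax; have n0n : (n0 <= n)%N by exact: leq_maxl.
have Nn : (Nmax%:R <= n%:R :> R) by rewrite ler_nat leq_maxr.
have hn k : (counting (over (cube N n k)) < (l * vol n)%:E :> \bar R)%E.
  have h : (ball_ratio a setT n%:R ((k, 0%R) : G) < l%:E)%E.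
    apply: le_lt_trans (hn0 n n0n); apply: ereal_sup_ubound.
    by exists (k, 0).
  move: h; rewrite ball_ratio_cube // natrK setIT lte_pdivrMr ?volume_gt0 //.
have fin k : finite_set (over (cube N n k)).
  by have := hn k; rewrite /counting; case: asboolP.
have self (x : G) : x \in cube N n x.1 by apply/mem_cube => j; rewrite subrr.
have finF (F : {fset G}) : finite_set (over F).
  apply: (@sub_finite_set _ _ (\bigcup_(x in [set` F]) over (cube N n x.1))).
    by move=> i /= iF; exists (a i) => //=; exact: self.
  by apply: bigcup_finite => //; exact: finite_fset.
split=> //; exists (Num.truncn (l * vol n)) => y F Fy.
have FS : (F `<=` fset_set (over (cube N n y.1)))%fset.
  apply/fsubsetP => i /Fy iy; rewrite in_fset_set // inE /= iy; exact: self.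
apply: leq_trans (fsubset_leq_card FS) _.
have := hn y.1; rewrite /counting asboolT // lte_fin => h.
by rewrite truncn_ge_nat; [exact: ltW|apply: le_trans (ltW h)].
Qed.

Hypothesis fin_over : forall F : {fset G}, finite_set (over F).

Lemma mem_over (F : {fset G}) i : (i \in fset_set (over F)) = (a i \in F).
Proof. by rewrite in_fset_set //; apply/idP/idP => [/set_mem|h]; last exact/mem_set. Qed.

Lemma lower_density_cube (l : R) : (l%:E < lower_density R a setT)%E ->
  exists n0, forall n, (n0 <= n)%N -> forall k : Z,
    l * vol n <= #|` fset_set (over (cube N n k))|%:R.
Proof.
move=> /limf_einf_gt/near_pinfty_nat[n0 hn0]; exists (maxn n0 Nmax) => n.
rewrite geq_max => /andP[n0n Nn] k.
rewrite -ler_pdivlMr ?volume_gt0 // -lee_fin; apply: le_trans (ltW (hn0 n n0n)) _.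
apply: ereal_inf_lbound; exists (k, 0) => //.
apply: ball_ratio_fset; rewrite ?ler_nat ?natrK //.
by rewrite setIT fset_setK.
Qed.

(** A set with exactly [m] points over each tile of a tiling by cubes of radius
    [r] has density [m / vol r]: the ball of radius [n] contains all tiles that
    meet the ball of radius [n - 2 r], and the tiles that meet it lie inside the
    ball of radius [n + 2 r]. *)
Lemma tiled_uniform_density (r m : nat) (J : Z -> {fset I}) :
  (forall z i, i \in J z -> tile r (a i) = z) -> (forall z, #|` J z| = m) ->
  uniform_density a [set i | i \in J (tile r (a i))] (m%:R / vol r)%:E.
Proof.
move=> Jt Jm; set JJ := [set i | _]; set D := m%:R / vol r.
have D0 : 0 <= D by rewrite divr_ge0 // ltW ?volume_gt0.
pose F n (k : Z) := [fset i in fset_set (over (cube N n k)) | i \in J (tile r (a i))]%fset.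
have FE n k : over (cube N n k) `&` JJ = [set` F n k].
  apply/seteqP; split=> i /=; rewrite !inE mem_over.
    by move=> [-> ->].
  by move=> /andP[].
have disJ z z' : z != z' -> [disjoint J z & J z']%fset.
  move=> zz'; apply/fdisjointP => i iz; apply/negP => iz'; move: zz'.
  by rewrite -(Jt _ _ iz) -(Jt _ _ iz') eqxx.
have tileE (z : Z) (x : G) : (x \in cube N r (center r z)) = (tile r x == z) by rewrite tile_cube.
have disC (z z' : Z) : z != z' ->
    [disjoint cube N r (center r z) & cube N r (center r z')]%fset.
  by move=> zz'; apply/fdisjointP => x; rewrite !tileE => /eqP ->.
have cardC (z : Z) : #|` cube N r (center r z)| = ((2 * r + 1) ^ d1 * #|torsion N|)%N.
  exact: card_cube.
(* Points of one tile are at distance at most [2 r] from each other. *)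
have near2 (x y : G) j : tile r x = tile r y -> (`|(x.1 j - y.1 j)%R| <= 2 * r)%N.
  move=> xy; have /mem_cube/(_ j) : x \in cube N r (center r (tile r x)) by rewrite tileE.
  have /mem_cube/(_ j) : y \in cube N r (center r (tile r x)) by rewrite tileE xy.
  move: (x.1 j) (y.1 j) (center _ _ _) => p q s'; lia.
have lo n k : D * vol n <= #|` F (n + 2 * r)%N k|%:R.
  pose Z1 := [fset tile r x | x in cube N n k]%fset.
  have h1 : (#|` cube N n k| <= #|` (\bigcup_(z <- Z1) cube N r (center r z))%fset|)%N.
    apply/fsubset_leq_card/fsubsetP => x xk; apply/bigfcupP; exists (tile r x).
      by rewrite andbT; apply/imfsetP; exists x.
    by rewrite tileE.
  rewrite (card_bigfcup_const _ disC cardC) card_cube in h1.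
  have h2 : (#|` (\bigcup_(z <- Z1) J z)%fset| <= #|` F (n + 2 * r)%N k|)%N.
    apply/fsubset_leq_card/fsubsetP => i /bigfcupP[z /andP[/imfsetP[x /= xk zE] _] iz].
    have it := Jt _ _ iz; rewrite !inE it iz andbT mem_over.
    apply/mem_cube => j; have /mem_cube/(_ j) := xk.
    have := @near2 x (a i) j; rewrite it zE => /(_ erefl).
    move: (x.1 j) ((a i).1 j) (k j) => p q s'; lia.
  rewrite (card_bigfcup_const _ disJ Jm) in h2.
  rewrite /D mulrAC ler_pdivrMr ?volume_gt0 //.
  apply: (@le_trans _ _ (m%:R * (#|` Z1| * ((2 * r + 1) ^ d1 * #|torsion N|))%N%:R)).
    by rewrite ler_wpM2l // ler_nat.
  by rewrite natrM mulrA ler_wpM2r ?(ltW (volume_gt0 _)) // -natrM ler_nat mulnC.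
have hi n k : #|` F n k|%:R <= D * vol (n + 2 * r).
  pose Z2 := [fset tile r x | x in cube N n k]%fset.
  have h1 : (#|` (\bigcup_(z <- Z2) cube N r (center r z))%fset| <= #|` cube N (n + 2 * r) k|)%N.
    apply/fsubset_leq_card/fsubsetP => y /bigfcupP[z /andP[/imfsetP[x /= xk zE] _]].
    rewrite tileE => /eqP yz; apply/mem_cube => j; have /mem_cube/(_ j) := xk.
    have := @near2 x y j; rewrite yz zE => /(_ erefl).
    move: (x.1 j) (y.1 j) (k j) => p q s'; lia.
  rewrite (card_bigfcup_const _ disC cardC) card_cube in h1.
  have h2 : (#|` F n k| <= #|` (\bigcup_(z <- Z2) J z)%fset|)%N.
    apply/fsubset_leq_card/fsubsetP => i; rewrite !inE mem_over.
    move=> /andP[ik iJ]; apply/bigfcupP; exists (tile r (a i)) => //.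
    by rewrite andbT; apply/imfsetP; exists (a i).
  rewrite (card_bigfcup_const _ disJ Jm) in h2.
  rewrite /D mulrAC ler_pdivlMr ?volume_gt0 //.
  apply: (@le_trans _ _ ((#|` Z2| * m)%N%:R * vol r)).
    by rewrite ler_wpM2r ?(ltW (volume_gt0 _)) // ler_nat.
  by rewrite -!natrM ler_nat mulnAC mulnC leq_mul2l h1 orbT.
have ratio n k (x : R) : Nmax%:R <= x -> Num.truncn x = n ->
    ball_ratio a JJ x k = (#|` F n k.1|%:R / vol n)%:E.
  by move=> Nx xn; rewrite ball_ratio_cube // xn FE counting_fset.
have lower : ((D%:E <= lower_density R a JJ)%E).
  apply/lee_subgt0Pr => e e0.
  (* [D + 1] instead of [D] keeps [th] positive when [m = 0]. *)
  pose th := (D + 1) / (D + 1 + e).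
  have th01 : 0 < th < 1 by rewrite divr_gt0 /= ?ltr_pdivrMr; lra.
  have [n0 hn0] := cube_volume_ratio (#|torsion N|) d1 (2 * r) (proj2 (andP th01)).
  rewrite -EFinB; apply: limf_einf_ge.
  have := nat_near_pinfty R (maxn Nmax (n0 + 2 * r)); apply: filterS => x [Nx nx].
  apply: le_ereal_inf_tmp => _ [k _ <-].
  rewrite (@ratio _ k x _ erefl); last by apply: le_trans Nx; rewrite ler_nat leq_maxl.
  rewrite lee_fin ler_pdivlMr ?volume_gt0 //; set n := Num.truncn x in nx *.
  have rn : (n0 + 2 * r <= n)%N by apply: leq_trans nx; exact: leq_maxr.
  have rn' : (2 * r <= n)%N by apply: leq_trans rn; exact: leq_addl.
  have h1 := lo (n - 2 * r)%N k.1; rewrite subnK // in h1; apply: le_trans h1.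
  have h2 := hn0 (n - 2 * r)%N; rewrite subnK // leq_subRL // addnC in h2.
  apply: le_trans (ler_wpM2l D0 (h2 rn)).
  rewrite mulrA ler_wpM2r ?(ltW (volume_gt0 _)) // /th mulrA ler_pdivlMr; last by lra.
  nra.
have upper : ((upper_density R a JJ <= D%:E)%E).
  apply/lee_addgt0Pr => e e0; pose th := (D + 1) / (D + 1 + e).
  have th01 : 0 < th < 1 by rewrite divr_gt0 /= ?ltr_pdivrMr; lra.
  have [n0 hn0] := cube_volume_ratio (#|torsion N|) d1 (2 * r) (proj2 (andP th01)).
  rewrite -EFinD; apply: limf_esup_le.
  have := nat_near_pinfty R (maxn Nmax n0); apply: filterS => x [Nx nx].
  apply: ge_ereal_sup => _ [k _ <-].
  rewrite (@ratio _ k x _ erefl); last by apply: le_trans Nx; rewrite ler_nat leq_maxl.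
  rewrite lee_fin ler_pdivrMr ?volume_gt0 //; set n := Num.truncn x in nx *.
  apply: le_trans (hi _ _) _.
  have := hn0 n (leq_trans (leq_maxr _ _) nx) => h.
  have De : 0 <= D + e by lra.
  apply: le_trans (ler_wpM2l De h).
  rewrite mulrA ler_wpM2r ?(ltW (volume_gt0 _)) // /th mulrA ler_pdivlMr; last by lra.
  nra.
have mid : (lower_density R a JJ <= upper_density R a JJ)%E.
  apply: limf_einf_le_esup; apply: nearW => x.
  apply: (@le_trans _ _ (ball_ratio a JJ x 0)).
    by apply: ereal_inf_lbound; exists 0.
  by apply: ereal_sup_ubound; exists 0.
by split; apply/eqP; rewrite eq_le ?lower ?upper ?(le_trans lower mid) ?(le_trans mid upper).
Qed.

End DensityOfMaps.

(** * Almost orthogonal tiles *)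

Section AlmostOrthogonalBlocks.
Variables (R : realType) (s : scalars).
Local Notation K := (scalar_field R s).
Variables (H : completeNormedModType K) (dot : {dot H for sconj s}).
Variables (I : choiceType) (f : I -> H).

Section OffDiagonal.
Variables (G : zmodType) (a : I -> G) (M : nat).
Hypothesis aM : forall y (F : {fset I}), (forall i, i \in F -> a i = y) -> (#|` F| <= M)%N.

(** Schur's test, with the multiplicity of [a] bounding the number of times each
    value of [p] occurs in a row or in a column. *)
Lemma schur_test (p : G -> R) (tau : R) (A : {fset I}) (b : I -> R) :
  (forall x, 0 <= p x) -> (forall F : {fset G}, \sum_(x <- F) p x <= tau) ->
  \sum_(i <- A) \sum_(j <- A) b i * b j * p (a i - a j) <=
  M%:R * tau * \sum_(i <- A) b i ^+ 2.
Proof.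
move=> p0 ptau.
have row i : \sum_(j <- A) p (a i - a j) <= M%:R * tau.
  apply: (sum_pullback_le (h := fun y => a i - y) A _ p0 ptau aM).
  by move=> y y' /addrI/oppr_inj.
have col j : \sum_(i <- A) p (a i - a j) <= M%:R * tau.
  apply: (sum_pullback_le (h := fun y => y - a j) A _ p0 ptau aM).
  by move=> y y' /addIr.
apply: (@le_trans _ _ (\sum_(i <- A) \sum_(j <- A)
    (b i ^+ 2 / 2 * p (a i - a j) + b j ^+ 2 / 2 * p (a i - a j)))).
  apply: ler_sum => i _; apply: ler_sum => j _; rewrite -mulrDl ler_wpM2r //.
  rewrite -subr_ge0 (_ : _ - _ = (b i - b j) ^+ 2 / 2) ?divr_ge0 ?sqr_ge0 //.
  by field.
under eq_bigr do rewrite big_split /=.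
rewrite big_split /= [X in _ + X]exchange_big /= [leRHS]mulrC [leRHS]splitr mulr_suml.
rewrite mulr_suml -big_split -big_split /=; apply: ler_sum => i _.
rewrite -!mulr_sumr; have bi : 0 <= b i ^+ 2 / 2 by rewrite divr_ge0 ?sqr_ge0.
by have := ler_wpM2l bi (row i); have := ler_wpM2l bi (col i); lra.
Qed.

End OffDiagonal.

Section Blocks.
Variable S : H -> H.
Hypothesis SP : forall k x y, S (k *: x + y) = k *: S x + S y.

Let S0 : S 0 = 0.
Proof. by have := SP (-1) 0 0; rewrite scaler0 addr0 scaleN1r addNr. Qed.

Let S_sum (X : Type) (r : seq X) (P : pred X) (b : X -> K) (x : X -> H) :
  S (\sum_(i <- r | P i) b i *: x i) = \sum_(i <- r | P i) b i *: S (x i).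
Proof. by elim/big_rec2: _ => // i y1 y2 _ <-; rewrite SP. Qed.

Let S_sum1 (X : Type) (r : seq X) (x : X -> H) :
  S (\sum_(i <- r) x i) = \sum_(i <- r) S (x i).
Proof.
have := S_sum r xpredT (fun=> 1) x; under eq_bigr do rewrite scale1r.
by move=> ->; apply: eq_bigr => i _; rewrite scale1r.
Qed.

(** The error is [<S (blk z), v - blk z>], summed over the labels [z]; it only
    involves pairs of indices with different labels, and the triangle inequality
    bounds it by the double sum. *)
Lemma block_form_ge (T : choiceType) (t : I -> T) (A : {fset I}) (b : I -> K)
    (blk : T -> H) (v : H) :
  (forall z, blk z = \sum_(i <- A | t i == z) b i *: f i) ->
  v = \sum_(i <- A) b i *: f i ->
  \sum_(z <- [fset t i | i in A]%fset) rpart (dot (S (blk z)) (blk z)) -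
  \sum_(i <- A) \sum_(j <- A | t j != t i)
     nrm (b i) * nrm (b j) * nrm (dot (S (f i)) (f j)) <=
  rpart (dot (S v) v).
Proof.
move=> blkE vA; set Z := [fset t i | i in A]%fset.
have vE : v = \sum_(z <- Z) blk z.
  by rewrite vA (partition_big_imfset _ t); apply: eq_bigr => z _; rewrite blkE.
rewrite [X in S X]vE S_sum1 dot_suml rpart_sum (partition_big_imfset _ t) -/Z.
rewrite -sumrB; apply: ler_sum => z _; rewrite lerBlDr.
pose w := \sum_(j <- A | t j != z) b j *: f j.
have -> : v = blk z + w by rewrite vA (bigID (fun i => t i == z)) blkE.
rewrite dotDr rpartD -addrA lerDl.
suff h : nrm (dot (S (blk z)) w) <= \sum_(i <- A | t i == z) \sum_(j <- A | t j != t i)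
     nrm (b i) * nrm (b j) * nrm (dot (S (f i)) (f j)).
  have := le_trans (ler_nrm_rpart _) h; rewrite ler_norml => /andP[h1 _].
  by rewrite -lerBlDr sub0r.
rewrite blkE S_sum dot_suml; apply: le_trans (ler_nrm_sum _ _ _) _.
apply: ler_sum => i /eqP ti; rewrite dot_sumr; apply: le_trans (ler_nrm_sum _ _ _) _.
rewrite ti; apply: ler_sum => j _; rewrite dotZl dotZr !nrmM nrm_sconj.
by rewrite mulrA.
Qed.

End Blocks.
End AlmostOrthogonalBlocks.

Lemma fset_subset_card (X : choiceType) (A : {fset X}) (m : nat) :
  (m <= #|` A|)%N -> exists2 B, (B `<=` A)%fset & #|` B| = m.
Proof.
move=> mA; exists [fset x in take m (enum_fset A)]%fset.
  by apply/fsubsetP => x; rewrite inE /= => /mem_take.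
by rewrite card_fseq undup_id ?take_uniq ?fset_uniq // size_takel.
Qed.

(** Points in the inner cubes of radius [n] of different tiles of radius [n + w]
    differ by more than [w] in the coordinate where the tile indices differ. *)
Lemma separated_tiles (n w : nat) (x y p q : int) : q != p ->
  (`|(y - q * (2 * (n + w) + 1)%:Z)%R| <= n)%N ->
  (`|(x - p * (2 * (n + w) + 1)%:Z)%R| <= n)%N -> (w < `|(x - y)%R|)%N.
Proof.
move=> qp; have D0 : (0 <= (2 * (n + w) + 1)%:Z :> int)%R by [].
have [h|h] : (q + 1 <= p \/ p + 1 <= q)%R by lia.
  have := ler_wpM2r D0 h; rewrite mulrDl mul1r.
  by move: (q * _)%R (p * _)%R => u v; lia.
have := ler_wpM2r D0 h; rewrite mulrDl mul1r.
by move: (q * _)%R (p * _)%R => u v; lia.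
Qed.

Section SelfLocalizedFamily.
Variables (R : realType) (s : scalars) (c : R -> R).
Hypothesis hc : finite_restricted_invertibility s c.
Local Notation K := (scalar_field R s).
Variables (H : completeNormedModType K) (dot : {dot H for sconj s}).
Hypothesis hdot : forall h : H, dot h h = `|h| ^+ 2.
Variables (I : choiceType) (f : I -> H) (BF u : R).
Hypotheses (hf : bessel_bound dot f BF) (hu : 0 < u) (hfu : forall i, u <= nrm (f i)).
Variables (d1 d2 : nat) (N : 'I_d2 -> nat) (a : I -> fgroup d1 N).
Local Notation G := (fgroup d1 N).
Local Notation Z := {ffun 'I_d1 -> int}.
Local Notation vol n := (((2 * n + 1) ^ d1 * #|torsion N|)%N%:R : R).
Local Notation over F := (a @^-1` [set` F]).
Hypothesis ha0 : (0 < lower_density R a setT)%E.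
Hypothesis ha : (lower_density R a setT <= upper_density R a setT)%E.
Hypothesis hay : (upper_density R a setT < +oo)%E.
Variables (S : H -> H) (alpha beta : R).
Hypothesis SP : forall k x y, S (k *: x + y) = k *: S x + S y.
Hypotheses (alpha0 : 0 < alpha) (alpha_beta : alpha <= beta).
Hypothesis Slower : forall h, alpha * nrm h ^+ 2 <= rpart (dot (S h) h).
Hypothesis Supper : forall h, rpart (dot (S h) h) <= beta * nrm h ^+ 2.
Hypothesis Sloc : ell1_dominated a a (fun i j => nrm (dot (S (f i)) (f j))).

(** The gap between [c eps'] and [c eps (1 - delta)] pays for the interaction of
    different tiles, the gap between [1 - eps'] and [1 - eps] for the points
    discarded near the walls of the tiles. *)
Lemma exists_smaller_eps (eps delta : R) : 0 < eps < 1 -> 0 < delta ->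
  exists2 eps', 0 < eps' < eps & c eps * (1 - delta) < c eps'.
Proof.
move=> heps d0; case: hc => c01 cc _ _; have /andP[ce0 _] := c01 _ heps.
have /andP[e0 e1] := heps.
have ein : eps \in [set` `]0, 1[] by rewrite inE /= in_itv.
move: cc; rewrite continuous_open_subspace; last exact: interval_open.
move=> /(_ eps ein).
move=> /cvgrPdist_lt /(_ (c eps * delta)); rewrite mulr_gt0 // => /(_ isT) [e /= e_gt0 he].
pose eps' := Num.max (eps / 2) (eps - e / 2).
have eps'lt : eps' < eps by rewrite gt_max; apply/andP; split; lra.
have eps'0 : 0 < eps' by rewrite lt_max; apply/orP; left; lra.
exists eps'; first by rewrite eps'0.
have : `|eps - eps'| < e.
  rewrite gtr0_norm ?subr_gt0 // ltrBlDr -ltrBlDl lt_max; apply/orP; right; lra.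
move=> /he; rewrite ltr_norml => /andP[_ h]; move: h; rewrite mulrBr mulr1; lra.
Qed.

(** For [S] the identity or the frame operator, the form [<S x, y>] compares with
    the norm, and localization makes it small between vectors over distant
    points. Inside the inner cube of each tile finite restricted invertibility
    provides a subfamily, cut down to the same cardinality for all tiles; vectors
    of different tiles lie over points more than [w] apart, so the form nearly
    decouples the tiles. The quotient [alpha / beta] is the price of passing
    between the form and the norm. *)
Lemma riesz_subfamily_fset (eps delta : R) : 0 < eps < 1 -> 0 < delta ->
  exists (J : set I) (D : \bar R),
    [/\ 0 < BF, uniform_density a J D,
        (((1 - eps) * u ^+ 2 / BF)%:E <= D / lower_density R a setT)%E &
        forall (A : {fset I}) (b : I -> K), (forall i, i \in A -> J i) ->
          c eps * (1 - delta) * (alpha / beta) * u ^+ 2 * \sum_(i <- A) nrm (b i) ^+ 2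
          <= nrm (\sum_(i <- A) b i *: f i) ^+ 2].
Proof.
move=> heps delta0; have [eps' heps' hceps'] := exists_smaller_eps heps delta0.
have /andP[eps0 eps1] := heps; have /andP[eps'0 eps'eps] := heps'.
have heps'1 : 0 < eps' < 1 by rewrite eps'0 (lt_trans eps'eps).
have beta0 : 0 < beta by exact: lt_le_trans alpha_beta.
have [fin_over [M aM]] := upper_density_fibres hay.
have [Dl DlE Dl0] : exists2 Dl : R, lower_density R a setT = Dl%:E & 0 < Dl.
  move: ha0 ha hay; case: (lower_density _ _ _) => [l|//|//].
  - by rewrite lte_fin => l0 _ _; exists l.
  - by move=> _ /le_lt_trans h /h.
have [p [p0 pfin pdom]] := Sloc.
(* [eta] is what the gap between [c eps'] and [c eps (1 - delta)] allows the
   interaction between tiles to cost; [M + 1] avoids a division by zero. *)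
pose eta := alpha * u ^+ 2 * (c eps' - c eps * (1 - delta)).
have eta0 : 0 < eta by rewrite !mulr_gt0 ?exprn_gt0 // subr_gt0.
pose tau := eta / (M%:R + 1).
have tau0 : 0 < tau by rewrite divr_gt0 // ltr_wpDl.
have [F0 _ F0tail] := @esum_tail R G setT (fun x => (p x)%:E) tau p0 pfin tau0.
pose w := (\max_(x <- F0) \max_(j < d1) `|x.1 j|)%N.
have far (x : G) j : (w < `|x.1 j|)%N -> x \notin F0.
  apply: contraTN => xF0; rewrite -leqNgt; apply: leq_trans (leq_bigmax_seq _ xF0 isT).
  exact: (leq_bigmax (F := fun j => `|x.1 j|%N)).
pose p' x := if x \in F0 then 0 else p x.
have p'0 x : 0 <= p' x by rewrite /p'; case: ifP.
have p'tau (F : {fset G}) : \sum_(x <- F) p' x <= tau.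
  rewrite /p' (big_fsetID _ (mem F0)) /= big1_fset ?add0r; last first.
    by move=> x; rewrite !inE => /andP[_ ->].
  rewrite -lee_fin -sumEFin (eq_big_seq (fun x => (p x)%:E)); last first.
    by move=> x; rewrite !inE => /andP[_ /negbTE->].
  by apply: F0tail => //; apply/fdisjointP => x xF0; rewrite !inE xF0 andbF.
(* The admissible loss [k1] is shared between the approximation of the lower
   density by [l] and the passage from the inner cubes to the tiles. *)
pose k1 := (1 - eps) / (1 - eps').
have e'1 : 0 < 1 - eps' by lra.
have k10 : 0 < k1 by rewrite divr_gt0 //; lra.
have k11 : k1 < 1 by rewrite ltr_pdivrMr //; lra.
pose l := Dl * ((1 + k1) / 2); pose th := 2 * k1 / (1 + k1).
have l0 : 0 < l by rewrite mulr_gt0 //; lra.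
have lDl : l < Dl by rewrite gtr_pMr //; lra.
have th1 : th < 1 by rewrite ltr_pdivrMr; lra.
have lth : l * th = k1 * Dl by rewrite /l /th; field; lra.
have [n1 hn1] : exists n0, forall n, (n0 <= n)%N -> forall k : Z,
    l * vol n <= #|` fset_set (over (cube N n k))|%:R.
  by apply: lower_density_cube; rewrite // DlE lte_fin.
have [n2 hn2] := cube_volume_ratio (#|torsion N|) d1 w th1.
pose n := maxn n1 n2; pose r := (n + w)%N.
pose xi := (1 - eps) * u ^+ 2 / BF * (Dl * vol r).
pose Az (z : Z) := fset_set (over (cube N n (center r z))).
have Az_card z : k1 * Dl * vol r <= #|` Az z|%:R.
  apply: le_trans (hn1 n (leq_maxl _ _) (center r z)); rewrite -lth -mulrA.
  by rewrite ler_wpM2l ?(ltW l0) // hn2 // leq_maxr.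
have Az0 z : Az z != fset0.
  rewrite -cardfs_gt0 -(ltr0n R); apply: lt_le_trans (Az_card z).
  by apply: mulr_gt0; [exact: mulr_gt0|exact: volume_gt0].
have BF0 : 0 < BF.
  have /fset0Pn[i _] := Az0 0; apply: (bessel_gt0 hdot (i := i) hf).
  exact: lt_le_trans (hfu i).
have /choice[J0 hJ0] (z : Z) := finite_subfamily hdot hc hf hu hfu heps'1 (Az0 z).
have J0_card z : xi <= #|` J0 z|%:R.
  have [_ h _] := hJ0 z; apply: le_trans h.
  have -> : xi = (1 - eps') * u ^+ 2 / BF * (k1 * Dl * vol r).
    by rewrite /xi /k1; field; rewrite !gt_eqF.
  apply: ler_wpM2l (Az_card z); apply: divr_ge0; last exact: ltW.
  by apply: mulr_ge0; [exact: ltW|exact: sqr_ge0].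
(* The least cardinality that occurs is still at least [xi]. *)
have [m [m_min mxi]] : exists m, (forall z, (m <= #|` J0 z|)%N) /\ xi <= m%:R.
  have ex_m : exists k, `[< exists z, #|` J0 z| = k >].
    by exists #|` J0 0|; apply/asboolP; exists 0.
  case: (ex_minnP ex_m) => m /asboolP[z0 z0E] m_min; exists m; split.
    by move=> z; apply: m_min; apply/asboolP; exists z.
  by rewrite -z0E.
have /choice[J hJ] (z : Z) : exists B, (B `<=` J0 z)%fset /\ #|` B| = m.
  by have [B] := fset_subset_card (m_min z); exists B.
have J_cube z i : i \in J z -> a i \in cube N n (center r z).
  have [/fsubsetP h1 _] := hJ z; have [/fsubsetP h2 _ _] := hJ0 z.
  by move=> /h1/h2; rewrite mem_over.
have J_tile z i : i \in J z -> tile r (a i) = z.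
  move=> /J_cube/mem_cube h; apply/eqP; rewrite tile_cube; apply/mem_cube => j.
  by apply: leq_trans (h j) _; exact: leq_addr.
exists [set i | i \in J (tile r (a i))], (m%:R / vol r)%:E; split=> //.
- apply: tiled_uniform_density => // z; exact: (proj2 (hJ z)).
- rewrite DlE inver gt_eqF // -EFinM lee_fin ler_pdivlMr // ler_pdivlMr ?volume_gt0 //.
  by rewrite -mulrA.
move=> A b AJ; pose t i := tile r (a i).
have AJt i : i \in A -> i \in J (t i) by exact: AJ.
set B2 := \sum_(i <- A) nrm (b i) ^+ 2; set v := \sum_(i <- A) b i *: f i.
have B20 : 0 <= B2 by apply: sumr_ge0 => i _; exact: sqr_ge0.
pose blk z := \sum_(i <- A | t i == z) b i *: f i.
have blk_ge z : c eps' * u ^+ 2 * \sum_(i <- A | t i == z) nrm (b i) ^+ 2 <= nrm (blk z) ^+ 2.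
  have [_ _ /(_ (fun i => if (i \in A) && (t i == z) then b i else 0))] := hJ0 z.
  have sub : ([fset i in A | t i == z] `<=` J0 z)%fset.
    apply/fsubsetP => i; rewrite !inE => /andP[/AJt iJ /eqP tz].
    by have [/fsubsetP h _] := hJ z; apply: h; rewrite -tz.
  rewrite /blk !(big_fset_condE _ A) /= => h.
  have -> : \sum_(i <- [fset i in A | t i == z]%fset) nrm (b i) ^+ 2 =
      \sum_(i <- J0 z) nrm (if (i \in A) && (t i == z) then b i else 0) ^+ 2.
    rewrite -(big_fset_incl _ sub) => [|i _]; last first.
      by rewrite !inE => /negbTE->; rewrite nrm0 expr0n.
    by apply: eq_big_seq => i; rewrite !inE => ->.
  have -> : \sum_(i <- [fset i in A | t i == z]%fset) b i *: f i =
      \sum_(i <- J0 z) (if (i \in A) && (t i == z) then b i else 0) *: f i.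
    rewrite -(big_fset_incl _ sub) => [|i _]; last first.
      by rewrite !inE => /negbTE->; rewrite scale0r.
    by apply: eq_big_seq => i; rewrite !inE => ->.
  exact: h.
have off_far i j : i \in A -> j \in A -> t j != t i -> a i - a j \notin F0.
  move=> iA jA tij; have [l' hl'] : exists l', t j l' != t i l'.
    apply/existsP; apply: contraNT tij => /existsPn h; apply/eqP/ffunP => l'.
    by apply/eqP; have := h l'; rewrite negbK.
  apply: (@far _ l'); rewrite /= !ffunE.
  have /mem_cube/(_ l') := J_cube _ _ (AJt i iA).
  have /mem_cube/(_ l') := J_cube _ _ (AJt j jA).
  rewrite !centerE => hj hi; apply: separated_tiles hl' hj hi.
have off_le : \sum_(i <- A) \sum_(j <- A | t j != t i)
    nrm (b i) * nrm (b j) * nrm (dot (S (f i)) (f j)) <= eta * B2.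
  apply: le_trans (_ : M%:R * tau * B2 <= _); last first.
    rewrite ler_wpM2r // /tau mulrCA ger_pMr // ler_pdivrMr ?mul1r ?ltr_wpDl //.
    by rewrite lerDl.
  apply: le_trans (schur_test aM A (fun i => nrm (b i)) p'0 p'tau).
  rewrite big_seq [leRHS]big_seq; apply: ler_sum => i iA.
  rewrite big_mkcond big_seq [leRHS]big_seq; apply: ler_sum => j jA.
  case: ifPn => tij; last by rewrite !mulr_ge0 ?nrm_ge0.
  rewrite ler_wpM2l ?mulr_ge0 ?nrm_ge0 // /p' (negbTE (off_far _ _ iA jA tij)).
  exact: pdom.
have hform := @block_form_ge _ _ _ dot _ f S SP _ t A b blk v (fun=> erefl) erefl.
have diag : alpha * (c eps' * u ^+ 2 * B2) <=
    \sum_(z <- [fset t i | i in A]%fset) rpart (dot (S (blk z)) (blk z)).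
  rewrite /B2 (partition_big_imfset _ t) /= !mulr_sumr; apply: ler_sum => z _.
  by apply: le_trans (Slower _); rewrite ler_wpM2l ?(ltW alpha0).
have total : c eps * (1 - delta) * alpha * u ^+ 2 * B2 <= beta * nrm v ^+ 2.
  apply: le_trans (Supper v); apply: le_trans hform.
  have -> : c eps * (1 - delta) * alpha * u ^+ 2 * B2 =
      alpha * (c eps' * u ^+ 2 * B2) - eta * B2 by rewrite /eta; ring.
  by rewrite lerB.
rewrite -(ler_pM2l beta0); apply: le_trans total; rewrite le_eqVlt; apply/orP; left.
by apply/eqP; field; rewrite gt_eqF.
Qed.

Lemma riesz_subfamily (eps delta : R) : 0 < eps < 1 -> 0 < delta ->
  exists (J : set I) (D : \bar R),
    [/\ uniform_density a J D,
        (((1 - eps) * u ^+ 2 / BF)%:E <= D / lower_density R a setT)%E &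
        forall b : I -> K, (sqsum J b < +oo)%E ->
        exists2 v : H, has_sum J (fun j => b j *: f j) v &
          ((c eps * (1 - delta) * (alpha / beta) * u ^+ 2)%:E * sqsum J b
           <= (nrm v ^+ 2)%:E)%E].
Proof.
move=> heps delta0; have [J [D [BF0 JD Dge Jb]]] := riesz_subfamily_fset heps delta0.
exists J, D; split=> // b bfin; set C := c eps * _ * _ * _ in Jb *.
have [v hv] := bessel_has_sum hdot BF0 hf bfin; exists v => //.
have sq0 : (0 <= sqsum J b)%E by apply: esum_ge0 => i _; rewrite lee_fin sqr_ge0.
have [C0|C0] := leP C 0.
  apply: (@le_trans _ _ 0%E); last by rewrite lee_fin sqr_ge0.
  by rewrite mule_le0_ge0 // lee_fin.
rewrite muleC -lee_pdivlMr //; apply: esum_le_fset => A AJ.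
rewrite sumEFin -EFinM lee_fin ler_pdivlMr // mulrC.
have nv0 : 0 <= Num.sqrt (C * \sum_(i <- A) nrm (b i) ^+ 2) by exact: sqrtr_ge0.
rewrite -[leLHS]sqr_sqrtr; last by rewrite mulr_ge0 ?(ltW C0) // sumr_ge0 // => i _; exact: sqr_ge0.
rewrite ler_pXn2r ?nnegrE ?nrm_ge0 //.
apply: (has_sum_nrm_ge (A0 := A) hv) => B AB.
rewrite -(@ler_pXn2r _ 2) ?nnegrE ?nrm_ge0 // sqr_sqrtr; last first.
  by rewrite mulr_ge0 ?(ltW C0) // sumr_ge0 // => i _; exact: sqr_ge0.
rewrite /partial_sum [X in nrm X]big_fset_condE /=.
have hB : forall i, i \in [fset i in B | i \in J]%fset -> J i.
  by move=> i; rewrite !inE => /andP[_ /set_mem].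
apply: le_trans (Jb _ b hB).
rewrite ler_wpM2l ?(ltW C0) //.
have sub : (A `<=` [fset i in B | i \in J])%fset.
  apply/fsubsetP => i iA; rewrite !inE (fsubsetP AB _ iA) /=.
  exact/mem_set/AJ.
rewrite [leRHS](big_fsetID _ (mem A)) /= (_ : [fset x in _ | x \in A]%fset = A).
  by rewrite lerDl sumr_ge0 // => i _; exact: sqr_ge0.
apply/fsetP => i; rewrite !inE andbC; case: (boolP (i \in A)) => //= /(fsubsetP sub).
by rewrite !inE.
Qed.

End SelfLocalizedFamily.

(** * Localized families *)

Section Localization.
Variables (R : realType) (s : scalars).
Local Notation K := (scalar_field R s).
Variables (H : completeNormedModType K) (dot : {dot H for sconj s}).
Hypothesis hdot : forall h : H, dot h h = `|h| ^+ 2.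
Variables (I : Type) (G : zmodType) (f : I -> H) (a : I -> G) (g : G -> H).

Lemma localized_dominated (X : choiceType) (h : X -> H) (e : X -> G) :
  localized dot 1 h e g ->
  ell1_dominated e id (fun i k => nrm (dot (h i) (g k))).
Proof.
move=> [r rfin hr]; exists (fun x => `|r x|); split=> [x|//|i k].
  exact: normr_ge0.
by apply: le_trans (hr i k) _; exact: ler_norm.
Qed.

Variables A B : R.
Hypothesis hg : frame_bounds dot g A B.
Hypothesis hloc : ell1_dominated a id (fun i k => nrm (dot (f i) (g k))).

Let hloc' : ell1_dominated id a (fun k i => nrm (dot (g k) (f i))).
Proof. by apply: ell1_dominated_sym hloc _ => i k; rewrite nrm_dotC. Qed.

Lemma frame_op_dominated :
  ell1_dominated a a (fun i j => nrm (dot (frame_op dot g (f i)) (f j))).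
Proof.
apply: (ell1_dominated_mul hloc hloc') => [i k|k i|i j]; try exact: nrm_ge0.
exact: (frame_op_dot_le hdot hg).
Qed.

(** The Gram matrix of [f] factors as (f against dual frame) times (frame against
    f), and the first factor is again a product of localized matrices. *)
Lemma gram_dominated :
  ell1_dominated id id (fun k l => nrm (dot (dual_frame dot g k) (dual_frame dot g l))) ->
  ell1_dominated a a (fun i j => nrm (dot (f i) (f j))).
Proof.
move=> hdual.
have h1 : ell1_dominated id a (fun k i => nrm (dot (dual_frame dot g k) (f i))).
  apply: (ell1_dominated_mul hdual hloc') => [i k|k i|i j]; try exact: nrm_ge0.
  exact: (dual_frame_dot_le hdot hg).
have h2 : ell1_dominated a id (fun i k => nrm (dot (f i) (dual_frame dot g k))).
  by apply: ell1_dominated_sym h1 _ => i k; rewrite nrm_dotC.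
apply: (ell1_dominated_mul h2 hloc') => [i k|k i|i j]; try exact: nrm_ge0.
exact: (dual_frame_dot_le hdot hg).
Qed.

End Localization.

Theorem theorem2p6 (R : realType) (s : scalars) (c : R -> R)
    (hc : finite_restricted_invertibility s c)
    (H : completeNormedModType (scalar_field R s)) (dot : {dot H for sconj s})
    (hdot : forall h : H, dot h h = `|h| ^+ 2)
    (I : countType) (f : I -> H) (BF u : R)
    (hf : bessel_bound dot f BF) (hu : 0 < u) (hfu : forall i, u <= nrm (f i))
    (d1 d2 : nat) (N : 'I_d2 -> nat) (g : fgroup d1 N -> H) (kappa : R)
    (hg : (exists AG BG : R, riesz_basis g AG BG /\ kappa = AG / BG) \/
          [/\ frame dot g, self_localized dot 1 (dual_frame dot g) & kappa = 1])
    (a : I -> fgroup d1 N)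
    (ha0 : (0 < lower_density R a setT)%E)
    (ha : (lower_density R a setT <= upper_density R a setT)%E)
    (hay : (upper_density R a setT < +oo)%E)
    (hloc : localized dot 1 f a g)
    (eps delta : R) (heps : 0 < eps < 1) (hdelta : 0 < delta) :
  exists (J : set I) (D : \bar R),
    [/\ uniform_density a J D,
        (D / lower_density R a setT >= ((1 - eps) * u ^+ 2 / BF)%:E)%E &
        forall b : I -> scalar_field R s, (sqsum J b < +oo)%E ->
        exists2 v : H, has_sum J (fun j => b j *: f j) v &
          ((nrm v ^+ 2)%:E >=
           (c eps * (1 - delta) * kappa * u ^+ 2)%:E * sqsum J b)%E].
Proof.
have hfg := localized_dominated hloc.
case: hg => [[AG [BG [hR ->]]]|[[AG [BG hF]] hself ->]].
  have hF := riesz_frame hdot hR.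
  have AG0 : 0 < AG by case: hF.
  have AB : AG <= BG by case: hF.
  apply: (riesz_subfamily hc hdot hf hu hfu ha0 ha hay _ AG0 AB _ _ _ heps hdelta).
  - exact: (frame_opP hdot hF).
  - exact: (frame_op_lower hdot hF).
  - exact: (frame_op_upper hdot hF).
  - exact: (frame_op_dominated hdot hF hfg).
have gramE (h : H) : 1 * nrm h ^+ 2 = rpart (dot h h).
  by rewrite mul1r (nrm_sqrE hdot).
have lower (h : H) : 1 * nrm h ^+ 2 <= rpart (dot h h) by rewrite gramE.
have upper (h : H) : rpart (dot h h) <= 1 * nrm h ^+ 2 by rewrite gramE.
have := riesz_subfamily (S := id) hc hdot hf hu hfu ha0 ha hay
  (fun _ _ _ => erefl) ltr01 (lexx 1) lower upper
  (gram_dominated hdot hF hfg (localized_dominated hself)) heps hdelta.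
by rewrite divr1.
Qed.
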